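(* Suppose there exist a sequence $\rho=(\rho_j)_{j\ge1}$ with $\rho_j>1$ and a number $\epsilon$ with $\theta<\epsilon<\kappa_{\min}$ such that $\sum_{j\ge1}\rho_j|\kappa_j(x)|\le\kappa_0(x)-\epsilon$ for all $x\in D$, and such that $(\rho_j^{-1})_{j\ge1}\in\ell^t(\mathbb N)$ for some $t\in(0,\infty)$. Then, with $s=\frac{2t}{2+t}\in(0,2)$, $$\sum_{\nu\in\mathcal F}\|t^u_\nu\|_{\mathcal V}^s<\infty\quad\text{and}\quad\sum_{\nu\in\mathcal F}\|t^p_\nu\|_{\mathcal Q}^t<\infty .$$
   Context: Spaces and forms. $D\subset\mathbb{R}^d$ is an open bounded domain; $\mathcal V,\mathcal Q$ are real Hilbert spaces with duals $\mathcal V',\mathcal Q'$; $f\in\mathcal V'$, $g\in\mathcal Q'$. $\mathcal K$ is a separable Banach space of real-valued essentially bounded functions on $D$ with $\operatorname{ess\,sup}_D|\kappa|\le\|\kappa\|_{\mathcal K}$. $b:\mathcal V\times\mathcal Q\to\mathbb R$ is bilinear, and $a(w,v;\kappa)=a_0(w,v)+a_1(w,v;\kappa)$ for $\kappa\in L^\infty(D)$, where $a_0$ and $a_1(\cdot,\cdot;\kappa)$ are bilinear on $\mathcal V\times\mathcal V$ and $a_1$ is linear in $\kappa$. Let $\mathcal V^0=\{v\in\mathcal V: b(v,q)=0\ \forall q\in\mathcal Q\}$. There are constants $c_1,C_1>0$, independent of $\kappa$, with: $a_1(v,v;\kappa)\ge c_1\operatorname{ess\,inf}_D\kappa\,\|v\|_{\mathcal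 V}^2$ for $v\in\mathcal V^0$ and $\kappa\ge0$; $a_1(w,v;\kappa)\le C_1\operatorname{ess\,sup}_D|\kappa|\,\|w\|_{\mathcal V}\|v\|_{\mathcal V}$ for all $w,v\in\mathcal V$; $a_1(w,v;\kappa)\le\frac12\big(a_1(w,w;|\kappa|)+a_1(v,v;|\kappa|)\big)$ for all $w,v\in\mathcal V$. Saddle point problem at $\kappa$: find $(u,p)\in\mathcal V\times\mathcal Q$ such that $a(u,v;\kappa)+b(v,p)=f(v)$ for all $v\in\mathcal V$ and $b(u,q)=g(q)$ for all $q\in\mathcal Q$. Well-posedness assumptions. There are $0<\theta<\Theta<\infty$ and constants $\gamma,\delta,\alpha,\beta>0$ such that for every $\kappa$ with $\theta\le\kappa(x)\le\Theta$ on $D$: $a(w,v;\kappa)\le\gamma\|w\|_{\mathcal V}\|v\|_{\mathcal V}$ for all $w,v\in\mathcal V$; $a(v,v;\kappa)\ge\alpha\|v\|_{\mathcal V}^2$ for all $v\in\mathcal V^0$; moreover $b(v,q)\le\delta\|v\|_{\mathcal V}\|q\|_{\mathcal Q}$ and $\inf_{q\in\mathcal Q}\sup_{v\in\mathcal V}\frac{b(v,q)}{\|v\|_{\mathcal V}\|q\|_{\mathcal Q}}\ge\beta$. Under these assumptions the problem has a unique solution. Affine parametrization. $U=[-1,1]^{\mathbb N}$, $\kappa(x,y)=\kappa_0(x)+\sum_{j\ge1}y_j\kappa_j(x)$ for $(x,y)\in D\times U$, with $\kappa_j\in\mathcal K$ for $j\ge0$, and $\theta<\kappa_{\min}:=\inf_{D\times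 U}\kappa\le\sup_{D\times U}\kappa=:\kappa_{\max}<\Theta/2$. $(u(y),p(y))$ denotes the solution at $\kappa=\kappa(\cdot,y)$. Taylor coefficients. $\mathcal F$ is the set of finitely supported sequences $\nu=(\nu_j)_{j\ge1}$ of nonnegative integers; $\nu!=\prod_j\nu_j!$; $t^\psi_\nu=\frac1{\nu!}\partial^\nu\psi(0)$ for $\psi=u,p$, where $\partial^\nu$ is the mixed partial derivative in $y$ of order $\nu$. *)

(* Defs.v *)
From HB Require Import structures.
From mathcomp Require Import all_boot all_order all_algebra finmap.
From mathcomp Require Import all_classical all_reals all_analysis ess_sup_inf.

Set Implicit Arguments.
Unset Strict Implicit.
Unset Printing Implicit Defensive.

Import Order.TTheory GRing.Theory Num.Theory.
Import numFieldNormedType.Exports.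

Local Open Scope classical_set_scope.
Local Open Scope ring_scope.

Section lebesgue_Rd.
Context {R : realType} (d : nat).
Local Notation X := 'rV[R]_d.+1.

(* The half-open box with corners c.1 and c.2; it is empty, and its volume is
   0, as soon as c.2 0 i <= c.1 0 i for some i. *)
Definition box (c : X * X) : set X :=
  [set x | forall i, x 0 i \in `]c.1 0 i, c.2 0 i]].

Definition box_vol (c : X * X) : R := \prod_i Num.max 0 (c.2 0 i - c.1 0 i).

Definition box_cover (A : set X) : set ((X * X) ^nat) :=
  [set c | A `<=` \bigcup_k box (c k)].

Definition lebesgue_outer (A : set X) : \bar R :=
  ereal_inf [set (\sum_(k <oo) (box_vol (c k))%:E)%E | c in box_cover A].

Lemma box_vol_ge0 c : 0 <= box_vol c.
Proof. by apply: prodr_ge0 => i _; rewrite le_max lexx. Qed.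

Let vol_ge0 c : (0 <= (box_vol c)%:E)%E.
Proof. by rewrite lee_fin box_vol_ge0. Qed.

Lemma lebesgue_outer_ge0 A : (0 <= lebesgue_outer A)%E.
Proof. by apply: le_ereal_inf_tmp => x [c _ <-]; exact: nneseries_ge0. Qed.

Lemma lebesgue_outer0 : lebesgue_outer set0 = 0%E.
Proof.
apply/eqP; rewrite eq_le lebesgue_outer_ge0 andbT.
apply: ereal_inf_lbound; exists (fun=> (0, 0)) => //=.
rewrite eseries0// => k _ _; rewrite /box_vol big_ord_recl /= !mxE subrr.
by rewrite maxxx mul0r.
Qed.

Lemma le_lebesgue_outer :
  {homo lebesgue_outer : A B / A `<=` B >-> (A <= B)%E}.
Proof.
move=> A B AB; apply/ereal_inf_le_tmp => _ [c cB <-]; exists c => //.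
exact: subset_trans cB.
Qed.

Lemma lebesgue_outer_sigma_subadditive : sigma_subadditive lebesgue_outer.
Proof.
move=> A; have [[i ioo]|] := pselect (exists i, lebesgue_outer (A i) = +oo%E).
  rewrite (eseries_pinfty _ _ ioo) ?leey// => n _.
  by rewrite -ltNye (lt_le_trans _ (lebesgue_outer_ge0 _)).
rewrite -forallNE => Aoo.
suff add2e (e : {posnum R}) : (lebesgue_outer (\bigcup_n A n) <=
    \sum_(i <oo) lebesgue_outer (A i) + e%:num%:E)%E.
  by apply/lee_addgt0Pr => _/posnumP[].
rewrite (le_trans _ (epsilon_trick _ _ _))//; last first.
  by move=> n; exact: lebesgue_outer_ge0.
pose P n (c : (X * X) ^nat) := box_cover (A n) c /\
  (\sum_(k <oo) (box_vol (c k))%:E <=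
   lebesgue_outer (A n) + (e%:num / (2 ^ n.+1)%:R)%:E)%E.
have [G PG] : {G : ((X * X) ^nat) ^nat & forall n, P n (G n)}.
  apply: (@choice _ _ P) => n; rewrite /P.
  have en1 : 0 < e%:num / (2 ^ n.+1)%:R by [].
  have fn : lebesgue_outer (A n) \is a fin_num.
    by rewrite ge0_fin_numE ?lebesgue_outer_ge0// ltey; apply/eqP; exact: Aoo.
  have [_ [c cA <-] cS] := lb_ereal_inf_adherent en1 fn.
  by exists c; split => //; exact/ltW.
pose F (nk : nat * nat) : \bar R := (box_vol (G nk.1 nk.2))%:E.
have F_ge0 nk : (0 <= F nk)%E by exact: vol_ge0.
apply: (@le_trans _ _ (\esum_(i in setT) F i)%E).
  apply: ereal_inf_lbound => /=.
  have /card_esym/ppcard_eqP[h] := card_nat2.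
  exists (fun k => G (h k).1 (h k).2).
    move=> t [n _ /(PG n).1[k _ Gt]]; exists (h^-1%FUN (n, k)) => //=.
    by rewrite invK ?inE.
  rewrite -(esum_pred_image F h xpredT) ?[fun=> _]set_true//.
  by rewrite image_eq.
rewrite (_ : esum _ _ = (\sum_(i <oo) \sum_(j <oo) F (i, j))%E); last first.
  pose J i : set (nat * nat) := [set (i, j) | j in setT].
  rewrite (_ : setT = \bigcup_k J k); last first.
    by rewrite predeqE => -[i j]; split => // _; exists i => //; exists j.
  rewrite esum_bigcupT//=; last first.
    apply/trivIsetP => i j _ _ ij; rewrite predeqE => -[n m] /=; split => //=.
    move=> -[[_ _ [<- _]]] [_ _ [ji _]].
    by rewrite ji eqxx in ij.
  rewrite -(image_id [set: nat]) -fun_true esum_pred_image//; last first.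
    by move=> n _; exact: esum_ge0.
  apply: eq_eseriesr => /= j _; rewrite -(esum_pred_image F (pair j) predT)//=.
    by congr esum; rewrite predeqE => -[m n]; split; move=> [i _ <-]; exists i.
  by move=> ? ? _ _; exact: (@can_inj _ _ _ snd).
apply: lee_lim.
- by apply: is_cvg_nneseries => n *; apply: nneseries_ge0.
- apply: is_cvg_nneseries => n *.
  by apply: adde_ge0 => //; exact: lebesgue_outer_ge0.
- by near=> n; apply: lee_sum => i _; exact: (PG i).2.
Unshelve. all: by end_near. Qed.

HB.instance Definition _ := isOuterMeasure.Build R X lebesgue_outer
  lebesgue_outer0 lebesgue_outer_ge0 le_lebesgue_outer
  lebesgue_outer_sigma_subadditive.

End lebesgue_Rd.

(* R^n with the Lebesgue (not Borel) sigma-algebra. *)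
Notation Rleb R d := (caratheodory_type (@lebesgue_outer R d)).

Definition lebesgue_Rd (R : realType) (d : nat) : set (Rleb R d) -> \bar R :=
  @lebesgue_outer R d.
HB.instance Definition _ (R : realType) (d : nat) :=
  isMeasure.Build _ (Rleb R d) R (@lebesgue_Rd R d)
    (@caratheodory_measure0 _ _ (@lebesgue_outer R d))
    (@caratheodory_measure_ge0 _ _ (@lebesgue_outer R d))
    (@caratheodory_measure_sigma_additive _ _ (@lebesgue_outer R d)).

Section essentially_bounded.
Context {R : realType} {d : nat} (D : set 'rV[R]_d.+1).
Implicit Types kappa : 'rV[R]_d.+1 -> R.

(* Functions are defined on the whole space; their values off D are discarded
   by patching them there with the neutral element of sup, resp. inf. *)
Definition ess_sup_on kappa : \bar R :=
  ess_sup (@lebesgue_Rd R d) (patch (cst -oo%E) D (EFin \o kappa)).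

Definition ess_inf_on kappa : \bar R :=
  ess_inf (@lebesgue_Rd R d) (patch (cst +oo%E) D (EFin \o kappa)).

Definition absf kappa : 'rV[R]_d.+1 -> R := fun x => `|kappa x|.

Definition Linfty_on kappa : Prop :=
  measurable_fun (D : set (Rleb R d)) (kappa : Rleb R d -> R) /\
  (ess_sup_on (absf kappa) < +oo)%E.

(* K is a separable Banach space whose elements are, through ev, functions on
   D: the linear structure is pointwise, elements are determined by their values
   on D, and the norm of K dominates the essential supremum. *)
Definition separable_Banach_function_space (K : completeNormedModType R)
    (ev : K -> 'rV[R]_d.+1 -> R) : Prop :=
  [/\ exists2 S : set K, countable S & dense S,
      forall (c : R) (k k' : K) x, D x -> ev (c *: k + k') x = c * ev k x + ev k' x,
      forall k k' : K, {in D, ev k =1 ev k'} -> k = k',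
      forall k, Linfty_on (ev k)
    & forall k, (ess_sup_on (absf (ev k)) <= `|k|%:E)%E].

End essentially_bounded.

Definition Hilbert {R : realType} (V : completeNormedModType R) : Prop :=
  exists dot : {biscalar V},
    (forall v w, dot v w = dot w v) /\ (forall v, dot v v = `|v| ^+ 2).

Section saddle_point.
Context {R : realType} {V Q : completeNormedModType R}.

Definition kernel_form (b : V -> Q -> R) : set V :=
  [set v | forall q, b v q = 0].

Definition inf_sup (b : V -> Q -> R) : \bar R :=
  ereal_inf [set ereal_sup [set (b v q / (`|v| * `|q|))%:E
                           | v in [set v : V | v != 0]]
            | q in [set q : Q | q != 0]].

Definition saddle_point_solution (a : V -> V -> R) (b : V -> Q -> R)
    (f : V -> R) (g : Q -> R) (u : V) (p : Q) : Prop :=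
  (forall v, a u v + b v p = f v) /\ (forall q, b u q = g q).

End saddle_point.

Definition param_cube {R : realType} : set (nat -> R) :=
  [set y | forall j, -1 <= y j <= 1].

(* The parameter y and the radii rho are indexed from 0, whereas kappa 0 is the
   mean: y j is the coefficient of kappa j.+1. *)
Definition affine_coef {R : realType} {X : Type} (kappa : nat -> X -> R)
    (y : nat -> R) (x : X) : R :=
  kappa 0%N x + limn (fun n => \sum_(0 <= j < n) y j * kappa j.+1 x).

Section Taylor.
Context {R : realType} {W : normedModType R}.
Implicit Types (psi : (nat -> R) -> W) (y : nat -> R) (js : seq nat).

Definition partial (j : nat) psi : (nat -> R) -> W :=
  fun y => derive1 (fun t : R => psi [eta y with j |-> t]) (y j).

(* d/dy_(j_1) (d/dy_(j_2) (... psi)) for js = [:: j_1; j_2; ...]. *)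
Definition partials js psi : (nat -> R) -> W := foldr partial psi js.

(* [derive1] is total, with a junk value where the derivative does not exist;
   this says that the iterated derivative partials js psi y genuinely exists. *)
Fixpoint ex_partials js psi y : Prop :=
  if js is j :: js' then
    (\forall t \near y j, ex_partials js' psi [eta y with j |-> t]) /\
    derivable (fun t : R => partials js' psi [eta y with j |-> t]) (y j) 1
  else True.

Definition multi_index := {fsfun nat -> nat with 0%N}.
Implicit Types nu : multi_index.

Definition multi_fact nu : nat := (\prod_(j <- finsupp nu) (nu j)`!)%N.

(* The increasing list of variables in which j is repeated nu j times. *)
Definition directions nu : seq nat :=
  flatten [seq nseq (nu j) j | j <- sort leq (finsupp nu)].

Definition Taylor_coef psi nu : W :=
  (multi_fact nu)%:R^-1 *: partials (directions nu) psi (fun=> 0).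

Definition ex_Taylor_coef psi nu : Prop :=
  ex_partials (directions nu) psi (fun=> 0).

End Taylor.

(* Main.v *)
(* The difference quotients of (u, p) in one parameter solve a saddle point problem with a
   homogeneous constraint, so coercivity on the kernel of b and the inf-sup condition make
   them Cauchy, and completeness yields the derivative. Iterating this, the Taylor
   coefficients solve, for nu != 0,
     a(t^u_nu, v; kappa_0) + b(v, t^p_nu) = - sum_(j in supp nu) a_1(t^u_(nu - e_j), v; kappa_j).
   Put w_nu = rho^nu t^u_nu and m_j(w) = a_1(w, w; rho_j |kappa_j|). Testing with w_nu and Young's
   inequality give
     a(w_nu, w_nu; kappa_0) <= 1/2 sum_(j in supp nu) (m_j(w_(nu - e_j)) + m_j(w_nu)),
   while the weight condition gives sum_j m_j(w) <= a(w, w; kappa_0) - a(w, w; eps) on the kernel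
   of b. Summed over a box of multi-indices, the terms a(w_nu, w_nu; kappa_0) cancel, and what
   remains bounds sum_nu |w_nu|^2. The inf-sup condition then bounds rho^nu t^p_nu uniformly
   in nu. Finally sum_nu rho^(- t nu) is a product of geometric series, and
   |t^u_nu|^s <= |w_nu|^2 + rho^(- t nu) by Young's inequality for products. *)
From HB Require Import structures.
Require Import Defs.
From mathcomp Require Import all_boot all_order all_algebra finmap.
From mathcomp Require Import all_classical all_reals all_analysis ess_sup_inf measurable_realfun.
From mathcomp Require Import ring lra.
Set Implicit Arguments.
Unset Strict Implicit.
Unset Printing Implicit Defensive.
Import Order.TTheory GRing.Theory Num.Theory.
Import numFieldNormedType.Exports.
Local Open Scope classical_set_scope.
Local Open Scope ring_scope.

(** * Derivatives as limits of difference quotients *)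

Section differentiation.
Context {R : realType} {W : completeNormedModType R}.
Implicit Types (U : R -> W) (t : R) (w : W).

Definition quotient U t0 t : W := (t - t0)^-1 *: (U t - U t0).

Lemma quotientE U t0 t : U t - U t0 = (t - t0) *: quotient U t0 t.
Proof.
have [->|tt0] := eqVneq t t0; first by rewrite !subrr scale0r.
by rewrite scalerA divff ?subr_eq0// scale1r.
Qed.

(** Clearing the denominator makes the case [t = t0] trivial, so a full neighbourhood replaces the
    punctured one and linear forms apply directly to the increments. *)
Lemma is_deriveP U t0 w : is_derive t0 1 U w <->
  forall e, 0 < e ->
    \forall t \near t0, `|U t - U t0 - (t - t0) *: w| <= e * `|t - t0|.
Proof.
have E : ((fun h => h^-1 *: ((U \o shift t0) (h *: 1) - U t0)) =
    (quotient U t0) \o +%R^~ t0).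
  by apply/funext => h /=; rewrite /quotient addrK [h *: 1]mulr1.
have dE t : t != t0 ->
    `|U t - U t0 - (t - t0) *: w| = `|t - t0| * `|w - quotient U t0 t|.
  by move=> _; rewrite quotientE -scalerBr normrZ (distrC w).
have S : (quotient U t0 @ t0^' --> w) <-> (forall e, 0 < e ->
    \forall t \near t0, `|U t - U t0 - (t - t0) *: w| <= e * `|t - t0|).
  split=> [H e e0|H].
    move/cvgrPdist_le : H => /(_ _ e0); rewrite near_withinE; apply: filterS => t He.
    have [->|tt0] := eqVneq t t0; first by rewrite !subrr scale0r subrr !normr0 mulr0.
    by rewrite dE// mulrC ler_wpM2r// He.
  apply/cvgrPdist_le => e /H; rewrite near_withinE; apply: filterS => t + tt0.
  by rewrite dE// mulrC ler_pM2r// normr_gt0 subr_eq0.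
have C x : ((fun h => h^-1 *: ((U \o shift t0) (h *: 1) - U t0)) @ 0^' --> (x : W))
    <-> (quotient U t0 @ t0^' --> x).
  have sh (P Q : set R) a c : (forall z, P (z + a - c) -> Q z) ->
      (\forall z \near a, P z) -> \forall z \near c, Q z.
    by move=> PQ; rewrite (near_shift c a); apply: filterS => z /= Pz; apply: PQ; rewrite -addrA.
  rewrite E; split=> /cvgrPdist_le H; apply/cvgrPdist_le => e /H; apply: sh => t /=.
    by rewrite addr0 subrK subr_eq0.
  rewrite subr0 => Ht t_neq0; apply: Ht.
  by apply: contraNneq t_neq0 => /eqP; rewrite -subr_eq0 addrK.
rewrite -S -C; split => [[d <-]|H]; first exact: d.
split; first by apply/cvg_ex; exists w.
exact: cvg_lim.
Qed.

(** Completeness of [W] supplies the limit of the quotients, before any candidate for the derivative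
    is known. *)
Lemma cauchy_is_derive U t0 :
  (forall e, 0 < e -> exists2 S : set R, nbhs t0 S &
     forall t t', S t -> S t' -> t != t0 -> t' != t0 ->
       `|quotient U t0 t - quotient U t0 t'| <= e) ->
  exists w, is_derive t0 1 U w.
Proof.
move=> H; suff [w Hw] : exists w, quotient U t0 @ t0^' --> (w : W).
  exists w; apply/is_deriveP => e e0; move/cvgrPdist_le : Hw => /(_ _ e0).
  rewrite near_withinE; apply: filterS => t He.
  have [->|tt0] := eqVneq t t0; first by rewrite !subrr scale0r subrr !normr0 mulr0.
  by rewrite quotientE -scalerBr normrZ mulrC ler_wpM2r// distrC He.
apply/cvg_ex; apply/cauchy_cvgP/cauchy_ballP => e e0.
have e20 : 0 < e / 2 by rewrite divr_gt0.
have [S S0 HS] := H _ e20.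
have FS : \forall t \near t0^', [set quotient U t0 t | t in S `&` [set~ t0]]
    (quotient U t0 t).
  rewrite near_withinE; apply: filterS S0 => t St /= tt0.
  by exists t => //; split => //; apply/eqP.
exists ([set quotient U t0 t | t in S `&` [set~ t0]],
        [set quotient U t0 t | t in S `&` [set~ t0]]) => //.
move=> [_ _] /= [[t [St /eqP tt0] <-] [t' [St' /eqP tt'0] <-]].
rewrite -ball_normE /=; apply: le_lt_trans (HS _ _ St St' tt0 tt'0) _.
by rewrite ltr_pdivrMr// mulr_natr mulr2n ltrDl.
Qed.

End differentiation.

(** * Saddle point problems *)

Section bounded_forms.
Context {R : realType} {V W : normedModType R}.

Definition form_bounded (A : V -> W -> R) (c : R) : Prop :=
  forall v w, A v w <= c * `|v| * `|w|.

Lemma form_bounded_norm (A : {bilinear V -> W -> R | *%R & *%R}) c v w :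
  form_bounded A c -> `|A v w| <= c * `|v| * `|w|.
Proof.
move=> Ac; rewrite ler_norml Ac andbT lerNl -linearNr.
by apply: le_trans (Ac _ _) _; rewrite normrN.
Qed.

End bounded_forms.

Section form_algebra.
Context {R : realType} {V W : lmodType R} (A : {bilinear V -> W -> R | *%R & *%R}).

Lemma formDl u v w : A (u + v) w = A u w + A v w. Proof. exact: linearDl. Qed.
Lemma formDr u v w : A u (v + w) = A u v + A u w. Proof. exact: linearDr. Qed.
Lemma formBl u v w : A (u - v) w = A u w - A v w. Proof. exact: linearBl. Qed.
Lemma formBr u v w : A u (v - w) = A u v - A u w. Proof. exact: linearBr. Qed.
Lemma formZl c u w : A (c *: u) w = c * A u w. Proof. exact: linearZl_LR. Qed.
Lemma formZr c u w : A u (c *: w) = c * A u w. Proof. exact: linearZr_LR. Qed.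
Lemma form0l w : A 0 w = 0. Proof. exact: linear0l. Qed.

End form_algebra.

Section saddle_point.
Context {R : realType} {V Q : completeNormedModType R}.
Context (b : {bilinear V -> Q -> R | *%R & *%R}) (delta beta : R).
Context (delta_ge0 : 0 <= delta) (beta_gt0 : 0 < beta) (b_bounded : form_bounded b delta).
Context (b_inf_sup : (beta%:E <= inf_sup b)%E).

(** For [q != 0] the supremum over [v] of the quotients is at least [beta] and at most [M / |q|]. In
    this form the inf-sup condition controls the second unknown. *)
Lemma inf_sup_le q M : 0 <= M -> (forall v, b v q <= M * `|v|) -> beta * `|q| <= M.
Proof.
move=> M0 bM; have [->|q0] := eqVneq q 0; first by rewrite normr0 mulr0.
have q_gt0 : 0 < `|q| by rewrite normr_gt0.
rewrite -ler_pdivlMr// -lee_fin; apply: (le_trans b_inf_sup).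
apply: (@le_trans _ _ (ereal_sup [set (b v q / (`|v| * `|q|))%:E
                           | v in [set v : V | v != 0]])).
  by apply: ereal_inf_lbound; exists q.
apply: ge_ereal_sup => _ [v /= v0 <-]; rewrite lee_fin.
have v_gt0 : 0 < `|v| by rewrite normr_gt0.
by rewrite invfM mulrA ler_wpM2r ?invr_ge0// ler_pdivrMr.
Qed.

Definition coercive_on_kernel (A : V -> V -> R) (alpha : R) : Prop :=
  forall v, kernel_form b v -> alpha * `|v| ^+ 2 <= A v v.

Context (gamma alpha : R) (gamma_gt0 : 0 < gamma) (alpha_gt0 : 0 < alpha).

(** With the test function [U] the term [b U P] vanishes, and coercivity on the kernel bounds [U].
    Then [b v P <= (1 + gamma / alpha) * M * |v|], and the inf-sup condition bounds [P]. *)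
Lemma saddle_point_stable (A : {biscalar V}) U P M :
  form_bounded A gamma -> coercive_on_kernel A alpha ->
  0 <= M -> (forall q, b U q = 0) ->
  (forall v, A U v + b v P <= M * `|v|) ->
  `|U| <= alpha^-1 * M /\ `|P| <= beta^-1 * (1 + gamma / alpha) * M.
Proof.
move=> Ag Aa M0 bU eqU; have U_le : `|U| <= alpha^-1 * M.
  rewrite mulrC ler_pdivlMr//; have [->|U0] := eqVneq U 0; first by rewrite normr0 mul0r.
  have U_gt0 : 0 < `|U| by rewrite normr_gt0.
  have := eqU U; rewrite bU addr0 => /(le_trans (Aa _ bU)).
  by rewrite expr2 mulrA ler_pM2r// mulrC.
split => //; rewrite -mulrA mulrC ler_pdivlMr// mulrC; apply: inf_sup_le => [|v].
  by rewrite mulr_ge0// addr_ge0// divr_ge0// ltW.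
have Av : - A U v <= gamma / alpha * M * `|v|.
  have := form_bounded_norm U v Ag; rewrite ler_norml => /andP[+ _].
  rewrite lerNl => /le_trans; apply; rewrite ler_wpM2r//.
  by rewrite -mulrA ler_wpM2l// ltW.
have := eqU v; lra.
Qed.

(** Differentiability of a curve of functionals in the dual norm: one neighbourhood of [t0] serves
    all [v]. *)
Definition fun_derive (F : R -> V -> R) (F' : V -> R) (t0 : R) : Prop :=
  forall e, 0 < e -> \forall t \near t0, forall v,
    `|F t v - F t0 v - (t - t0) * F' v| <= e * `|t - t0| * `|v|.


(** * Differentiating a saddle point problem in one real parameter *)

Section derivative.
Context (A B : {biscalar V}) (cB cF : R) (F : R -> V -> R) (F' : V -> R)
  (G : Q -> R) (U : R -> V) (P : R -> Q) (t0 : R).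
Context (A_bounded : form_bounded A gamma) (A_coercive : coercive_on_kernel A alpha).
Context (cB_ge0 : 0 <= cB) (cF_ge0 : 0 <= cF).
Context (B_bounded : form_bounded B cB) (F'_bounded : forall v, `|F' v| <= cF * `|v|).
Context (F_derive : fun_derive F F' t0).
Context (UP_solution : \forall t \near t0,
  (forall v, A (U t) v + (t - t0) * B (U t) v + b v (P t) = F t v) /\
  forall q, b (U t) q = G q).

Let eq0 : (forall v, A (U t0) v + b v (P t0) = F t0 v) /\ forall q, b (U t0) q = G q.
Proof.
have [e1 e2] := nbhs_singleton UP_solution.
by split => // v; rewrite -e1 subrr mul0r addr0.
Qed.

Let dU := quotient U t0.
Let dP := quotient P t0.

Let UE t : U t = U t0 + (t - t0) *: dU t.
Proof. by rewrite -quotientE addrC subrK. Qed.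

Let PE t : P t = P t0 + (t - t0) *: dP t.
Proof. by rewrite -quotientE addrC subrK. Qed.

(** Subtracting the equations at [t] and [t0] and dividing by [t - t0] leaves the equation of the
    derivative up to a small functional. The datum [G] is constant in [t], so the constraint becomes
    homogeneous. *)
Let deq e : 0 < e -> \forall t \near t0, t != t0 ->
  (forall v, `|A (dU t) v + b v (dP t) + B (U t) v - F' v| <= e * `|v|) /\
  forall q, b (dU t) q = 0.
Proof.
move=> /F_derive; apply: filterS2 UP_solution => t [e1 e2] Ft tt0.
have h_gt0 : 0 < `|t - t0| by rewrite normr_gt0 subr_eq0.
split => [v|q].
  rewrite -(ler_pM2l h_gt0) mulrA (mulrC _ e) -normrM.
  have <- : F t v - F t0 v - (t - t0) * F' v =
      (t - t0) * (A (dU t) v + b v (dP t) + B (U t) v - F' v).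
    rewrite -e1 -eq0.1; move: (dU t) (dP t) (UE t) (PE t) => D E -> ->.
    by rewrite !(formDl A) !(formDl B) !(formZl A) !(formZl B) (formDr b) (formZr b); ring.
  exact: Ft.
have /eqP := e2 q; rewrite UE (formDl b) (formZl b) eq0.2 -subr_eq0 addrAC subrr add0r.
by rewrite mulf_eq0 subr_eq0 (negPf tt0) => /eqP.
Qed.

Let near_le r : 0 < r -> \forall t \near t0, `|t - t0| <= r.
Proof.
move=> r0; have := @cvgr_dist_le _ _ _ (nbhs t0) _ id t0 cvg_id _ r0.
by move=> H; near=> t; rewrite distrC; near: t; exact: H.
Unshelve. all: by end_near. Qed.

(* The equation for the increment bounds it by [|t - t0|], plus a small multiple of itself. *)
Let lipschitz : exists2 L, 0 <= L & \forall t \near t0, `|U t - U t0| <= L * `|t - t0|.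
Proof.
pose c := 1 + cF + cB * `|U t0|.
have c_ge0 : 0 <= c by rewrite !addr_ge0// mulr_ge0.
exists (2 * alpha^-1 * c); first by rewrite !mulr_ge0// invr_ge0 ltW.
(* Within this radius [cB * |t - t0| <= alpha / 2], so this part takes up only half of the
   coercivity; [cB + 1] avoids a zero denominator. *)
have r_gt0 : 0 < alpha / (2 * (cB + 1)) by rewrite divr_gt0// mulr_gt0// ltr_wpDl.
apply: filterS2 (near_le r_gt0) (deq ltr01) => t tr Ht.
have [->|tt0] := eqVneq t t0; first by rewrite !subrr !normr0 mulr0.
have [e1 e2] := Ht tt0.
rewrite quotientE -/dU normrZ mulrC ler_wpM2r//.
have h_ge0 : 0 <= `|t - t0| by [].
have d_ge0 : 0 <= `|dU t| by [].
have [] := @saddle_point_stable A (dU t) (dP t) (c + cB * (`|t - t0| * `|dU t|))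
    A_bounded A_coercive.
- by rewrite addr_ge0// !mulr_ge0.
- exact: e2.
- move=> v; have := form_bounded_norm (U t) v B_bounded; have := F'_bounded v; have := e1 v.
  have : cB * `|U t| * `|v| <= cB * (`|U t0| + `|t - t0| * `|dU t|) * `|v|.
    rewrite ler_wpM2r// ler_wpM2l// -normrZ -quotientE.
    by apply: le_trans (ler_normD _ _); rewrite addrC subrK.
  rewrite /c !ler_norml => ? /andP[? ?] /andP[? ?] /andP[? ?]; lra.
move=> + _; rewrite -ler_pdivrMl ?invr_gt0// invrK.
have : cB * (`|t - t0| * `|dU t|) <= alpha / 2 * `|dU t|.
  rewrite mulrA ler_wpM2r//.
  apply: (@le_trans _ _ ((cB + 1) * `|t - t0|)); first by rewrite ler_wpM2r// lerDl.
  rewrite mulrC -ler_pdivlMr ?ltr_wpDl//; apply: le_trans tr _.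
  by rewrite invfM mulrA.
move=> h1 h2; rewrite -(ler_pM2l alpha_gt0) mulrA [alpha * (2 * _)]mulrCA divff ?gt_eqF//; lra.
Qed.

(** By the Lipschitz bound [B (U t)] may be replaced by [B (U t0)]. The limit functional is then the
    same for all [t] and cancels when two quotients are compared. *)
Let deq0 e : 0 < e -> \forall t \near t0, t != t0 ->
  (forall v, `|A (dU t) v + b v (dP t) - (F' v - B (U t0) v)| <= e * `|v|) /\
  forall q, b (dU t) q = 0.
Proof.
move=> e0; have [L L0 HL] := lipschitz.
have r_gt0 : 0 < e / (2 * (cB * L + 1)) by rewrite divr_gt0// mulr_gt0// ltr_wpDl// mulr_ge0.
have e20 : 0 < e / 2 by rewrite divr_gt0.
apply: filterS3 (near_le r_gt0) HL (deq e20) => t tr UL Ht tt0.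
have [e1 e2] := Ht tt0; split => // v.
have : `|B (U t - U t0) v| <= e / 2 * `|v|.
  apply: le_trans (form_bounded_norm _ _ B_bounded) _; rewrite ler_wpM2r//.
  apply: (@le_trans _ _ ((cB * L + 1) * `|t - t0|)).
    by rewrite mulrDl -mulrA; apply: ler_wpDr; rewrite ?mulr_ge0// ler_wpM2l.
  rewrite mulrC -ler_pdivlMr ?ltr_wpDl ?mulr_ge0//; apply: le_trans tr _.
  by rewrite invfM mulrA.
rewrite (formBl B); move: (e1 v); rewrite !ler_norml => /andP[? ?] /andP[? ?]; lra.
Qed.

Let cauchy e : 0 < e -> exists2 S : set R, nbhs t0 S &
  forall t t', S t -> S t' -> t != t0 -> t' != t0 ->
    `|dU t - dU t'| <= e /\ `|dP t - dP t'| <= e.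
Proof.
(* The number [k] exceeds both stability constants. Two defects [e / (2 * k)] add up to [e / k],
   which stability turns into at most [e]. *)
move=> e0; pose k := alpha^-1 + beta^-1 * (1 + gamma / alpha) + 1.
have a_gt0 : 0 < alpha^-1 by rewrite invr_gt0.
have bg_gt0 : 0 < beta^-1 * (1 + gamma / alpha).
  by rewrite mulr_gt0 ?invr_gt0// addr_gt0// divr_gt0.
have k_gt0 : 0 < k by rewrite !addr_gt0.
have e'0 : 0 < e / (2 * k) by rewrite divr_gt0// mulr_gt0.
exists (fun t => t != t0 ->
  (forall v, `|A (dU t) v + b v (dP t) - (F' v - B (U t0) v)| <= e / (2 * k) * `|v|) /\
  forall q, b (dU t) q = 0); first exact: deq0.
move=> t t' /[swap] Ht' /[swap] tt0 /(_ tt0) [e1 k1] /[dup] t't0 /Ht' [e2 k2].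
have [] := @saddle_point_stable A (dU t - dU t') (dP t - dP t') (e / k) A_bounded A_coercive.
- by rewrite ltW// divr_gt0.
- by move=> q; rewrite (formBl b) k1 k2 subrr.
- move=> v; have := e1 v; have := e2 v; rewrite (formBl A) (formBr b) !ler_norml.
  rewrite invfM [2^-1 * _]mulrC (mulrA e); move: (e / k) => ek.
  by move=> /andP[? ?] /andP[? ?]; lra.
have ke x : 0 < x -> x <= k -> x * (e / k) <= e.
  by move=> x0 xk; rewrite mulrCA ger_pMr// ler_pdivrMr// mul1r.
move=> /le_trans -> ; last by apply: ke => //; rewrite /k; lra.
by move=> /le_trans -> => //; apply: ke => //; rewrite /k; lra.
Qed.

Lemma saddle_point_derive : exists U' P',
  [/\ is_derive t0 1 U U', is_derive t0 1 P P',
      forall v, A U' v + b v P' = F' v - B (U t0) v & forall q, b U' q = 0].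
Proof.
have [U' dU'] : exists w, is_derive t0 1 U w.
  apply: cauchy_is_derive => e /cauchy[S S0 HS]; exists S => // t t' *.
  by apply: (HS t t' _ _ _ _).1.
have [P' dP'] : exists w, is_derive t0 1 P w.
  apply: cauchy_is_derive => e /cauchy[S S0 HS]; exists S => // t t' *.
  by apply: (HS t t' _ _ _ _).2.
(* Quotients at a single [t] close to [t0] stand in for the derivatives, with error [e] in both
   unknowns and in the equation. *)
have lim e : 0 < e -> exists D E,
   [/\ `|U' - D| <= e, `|P' - E| <= e,
    forall v, `|A D v + b v E - (F' v - B (U t0) v)| <= e * `|v| & forall q, b D q = 0].
  move=> e0; near t0^' => t.
  have nbhs_dnbhs (S : set R) : nbhs t0 S -> t0^' S.
    by move=> S0; rewrite /dnbhs /within /=; apply: filterS S0.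
  have tt0 : t != t0 by near: t; exact: nbhs_dnbhs_neq.
  have h0 : 0 < `|t - t0| by rewrite normr_gt0 subr_eq0.
  have [] : t != t0 ->
    (forall v, `|A (dU t) v + b v (dP t) - (F' v - B (U t0) v)| <= e * `|v|) /\
    forall q, b (dU t) q = 0 by near: t; apply: nbhs_dnbhs; exact: deq0.
    by [].
  exists (dU t), (dP t); split => //.
    rewrite distrC -(ler_pM2l h0) -normrZ scalerBr -quotientE mulrC; near: t.
    by apply: nbhs_dnbhs; apply: (is_deriveP _ _ _).1.
  rewrite distrC -(ler_pM2l h0) -normrZ scalerBr -quotientE mulrC; near: t.
  by apply: nbhs_dnbhs; apply: (is_deriveP _ _ _).1.
have zero (x c : R) : 0 <= c -> (forall e, 0 < e -> `|x| <= e * c) -> x = 0.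
  move=> c0 H; apply/eqP; rewrite -normr_le0; apply/ler_addgt0Pr => e e0; rewrite add0r.
  have c1 : 0 < c + 1 by rewrite ltr_wpDl.
  apply: le_trans (H _ (divr_gt0 e0 c1)) _.
  by rewrite -mulrA ger_pMr// mulrC ler_pdivrMr// mul1r lerDl.
exists U', P'; split => // [v|q].
  apply/eqP; rewrite -subr_eq0; apply/eqP; apply: (zero _ ((gamma + delta + 1) * `|v|)).
    by rewrite mulr_ge0// !addr_ge0// ltW.
  move=> e /lim[D [E [DU EP HDE _]]].
  have := HDE v; have := form_bounded_norm (U' - D) v A_bounded.
  have := form_bounded_norm v (P' - E) b_bounded.
  have : gamma * `|U' - D| * `|v| <= gamma * e * `|v| by rewrite ler_wpM2r// ler_wpM2l// ltW.
  have : delta * `|v| * `|P' - E| <= delta * `|v| * e by rewrite ler_wpM2l// mulr_ge0.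
  rewrite (formBl A) (formBr b) !ler_norml => ? ? /andP[? ?] /andP[? ?] /andP[? ?].
  by apply/andP; split; lra.
apply: (zero _ (delta * `|q|)); first by rewrite mulr_ge0.
move=> e /lim[D [E [DU _ _ bD]]].
rewrite -[b U' q]subr0 -(bD q) -(formBl b).
apply: le_trans (form_bounded_norm _ _ b_bounded) _.
by rewrite -mulrA mulrCA ler_wpM2r// mulr_ge0.
Unshelve. all: by end_near. Qed.

End derivative.

End saddle_point.

(** * Iterated partial derivatives of the solution *)

Section sum_of_forms.
Context {R : realType} {V : completeNormedModType R} {I : eqType}.
Context (B : I -> {biscalar V}) (cB : I -> R) (U : I -> R -> V) (U' : I -> V) (t0 : R).
Context (B_bounded : forall i, form_bounded (B i) (cB i)) (cB_ge0 : forall i, 0 <= cB i).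
Context (f : V -> R) (r : seq I) (dU : {in r, forall i, is_derive t0 1 (U i) (U' i)}).

(** Right-hand sides of this kind arise when the equation is differentiated repeatedly. Boundedness
    of the forms makes the estimate uniform in [v]; the tolerance is divided by the sum of their
    bounds, plus 1. *)
Lemma fun_derive_sum :
  fun_derive (fun t v => f v - \sum_(i <- r) B i (U i t) v)
             (fun v => - \sum_(i <- r) B i (U' i) v) t0.
Proof.
move=> e e0; pose c := \sum_(i <- r) cB i.
have c_ge0 : 0 <= c by exact: sumr_ge0.
have c1_gt0 : 0 < c + 1 by rewrite ltr_wpDl.
have ec_gt0 : 0 < e / (c + 1) by rewrite divr_gt0.
have : \forall t \near t0, forall i, i \in r ->
    `|U i t - U i t0 - (t - t0) *: U' i| <= e / (c + 1) * `|t - t0|.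
  elim: r dU => [|i s IHs] H; first by near=> t => i.
  have Hs : {in s, forall k, is_derive t0 1 (U k) (U' k)}.
    by move=> k ks; apply: H; rewrite inE ks orbT.
  have Hi : is_derive t0 1 (U i) (U' i) by apply: H; rewrite inE eqxx.
  apply: filterS2 ((is_deriveP _ _ _).1 Hi _ ec_gt0) (IHs Hs) => t h1 h2 k.
  by rewrite inE => /predU1P[->|] //; exact: h2.
apply: filterS => t Ht v.
have -> : f v - \sum_(i <- r) B i (U i t) v - (f v - \sum_(i <- r) B i (U i t0) v)
    - (t - t0) * (- \sum_(i <- r) B i (U' i) v) =
    - \sum_(i <- r) B i (U i t - U i t0 - (t - t0) *: U' i) v.
  have -> : \sum_(i <- r) B i (U i t - U i t0 - (t - t0) *: U' i) v =
      \sum_(i <- r) (B i (U i t) v - B i (U i t0) v - (t - t0) * B i (U' i) v).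
    by apply: eq_bigr => i _; rewrite 2!(formBl (B i)) (formZl (B i)).
  by rewrite !sumrB -mulr_sumr; ring.
rewrite normrN; apply: le_trans (ler_norm_sum _ _ _) _.
apply: (@le_trans _ _ (\sum_(i <- r) cB i * (e / (c + 1) * `|t - t0| * `|v|))).
  rewrite !big_seq; apply: ler_sum => i ir.
  apply: le_trans (form_bounded_norm _ _ (B_bounded i)) _.
  by rewrite -!mulrA ler_wpM2l// !mulrA ler_wpM2r// Ht.
rewrite -mulr_suml -/c !mulrA ler_wpM2r// ler_wpM2r//.
by rewrite ler_pdivrMr// mulrC ler_wpM2l ?lerDl// ltW.
Unshelve. all: by end_near. Qed.

Lemma sum_of_forms_bounded v :
  `|- \sum_(i <- r) B i (U' i) v| <= (\sum_(i <- r) cB i * `|U' i|) * `|v|.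
Proof.
rewrite normrN mulr_suml; apply: le_trans (ler_norm_sum _ _ _) _.
by apply: ler_sum => i _; exact: form_bounded_norm.
Qed.

End sum_of_forms.

(** The terms of the Leibniz rule for a form affine in each parameter: the removed entry is the one
    derivative that falls on the form, the remaining ones fall on the solution. A repeated entry is
    removed once per occurrence. *)
Fixpoint deletions (js : seq nat) : seq (nat * seq nat) :=
  if js is j :: js' then (j, js') :: [seq (il.1, j :: il.2) | il <- deletions js']
  else [::].

Lemma deletions_size js il : il \in deletions js -> size js = (size il.2).+1.
Proof.
elim: js il => [//|j js IH] il; rewrite inE => /predU1P[->//|/mapP[kl kls ->]] /=.
by rewrite (IH kl).
Qed.

Section parametric_saddle_point.
Context {R : realType} {V Q : completeNormedModType R}.
Context (b : {bilinear V -> Q -> R | *%R & *%R}) (delta beta gamma alpha : R).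
Context (delta_ge0 : 0 <= delta) (beta_gt0 : 0 < beta).
Context (gamma_gt0 : 0 < gamma) (alpha_gt0 : 0 < alpha).
Context (b_bounded : form_bounded b delta) (b_inf_sup : (beta%:E <= inf_sup b)%E).

(** Here every coordinate can move in both directions, as two-sided partial derivatives require. *)
Definition open_cube : set (nat -> R) := [set y | forall j, `|y j| < 1].

Context (A : (nat -> R) -> {biscalar V}) (B : nat -> {biscalar V}) (cB : nat -> R).
Context (A_bounded : forall y, open_cube y -> form_bounded (A y) gamma).
Context (A_coercive : forall y, open_cube y -> coercive_on_kernel b (A y) alpha).
Context (B_bounded : forall j, form_bounded (B j) (cB j)) (cB_ge0 : forall j, 0 <= cB j).
Context (A_affine : forall y j t, open_cube y -> `|t| < 1 ->
  forall w v, A [eta y with j |-> t] w v = A y w v + (t - y j) * B j w v).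
Context (f : V -> R) (g : Q -> R) (u : (nat -> R) -> V) (p : (nat -> R) -> Q).
Context (up_solution : forall y, open_cube y -> saddle_point_solution (A y) b f g (u y) (p y)).

Lemma with_same (y : nat -> R) j : ([eta y with j |-> y j] : nat -> R) = y.
Proof. by apply/funext => i /=; case: eqP => // ->. Qed.

Lemma open_cube_with y j t : open_cube y -> `|t| < 1 -> open_cube [eta y with j |-> t].
Proof. by move=> yc t1 i /=; case: eqP. Qed.

Lemma near_open_cube y j : open_cube y ->
  \forall t \near y j, open_cube [eta y with j |-> t].
Proof.
move=> yc; have : \forall t \near y j, `|t| < 1.
  by apply: (@cvgr_norm_lt _ _ _ (nbhs (y j)) _ id (y j) cvg_id); exact: yc.
by apply: filterS => t; exact: open_cube_with.
Qed.

(** The parametric problem differentiated by the Leibniz rule; [f] and [g] do not depend on [y], so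
    they survive only for the empty list. *)
Definition partials_equation (js : seq nat) y : Prop :=
  saddle_point_solution (A y) b
    (fun v => (js == [::])%:R * f v
              - \sum_(il <- deletions js) B il.1 (partials il.2 u y) v)
    (fun q => (js == [::])%:R * g q) (partials js u y) (partials js p y).

Let derivable_at {W : normedModType R} (psi : (nat -> R) -> W) y :=
  forall j, derivable (fun t : R => psi [eta y with j |-> t]) (y j) 1.

(** When only [y j] moves, the form is affine with slope [B j] and the constraint is constant, so
    [saddle_point_derive] applies. Derivability along the lists in [deletions js] makes the
    right-hand side differentiable. *)
Lemma partials_equationS js :
  (forall y, open_cube y -> partials_equation js y) ->
  (forall il y, il \in deletions js -> open_cube y -> derivable_at (partials il.2 u) y) ->
  forall y, open_cube y ->
    [/\ derivable_at (partials js u) y, derivable_at (partials js p) y &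
        forall j, partials_equation (j :: js) y].
Proof.
move=> eq_js d_js y yc.
suff H j : [/\ derivable (fun t : R => partials js u [eta y with j |-> t]) (y j) 1,
    derivable (fun t : R => partials js p [eta y with j |-> t]) (y j) 1 &
    partials_equation (j :: js) y] by split => j; have [] := H j.
pose U t := partials js u [eta y with j |-> t].
pose P t := partials js p [eta y with j |-> t].
pose Ul (il : nat * seq nat) t := partials il.2 u [eta y with j |-> t].
pose Ul' (il : nat * seq nat) := partials (j :: il.2) u y.
have dUl : {in deletions js, forall il, is_derive (y j) 1 (Ul il) (Ul' il)}.
  move=> il ils; rewrite /Ul' /= /partial derive1E.
  by apply/derivableP; exact: d_js.
have cF_ge0 : 0 <= \sum_(il <- deletions js) cB il.1 * `|Ul' il|.
  by apply: sumr_ge0 => il _; rewrite mulr_ge0.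
have [|U' [P' [dU dP eqU' bU']]] := @saddle_point_derive _ _ _ b _ _ delta_ge0 beta_gt0
    b_bounded b_inf_sup _ _ gamma_gt0 alpha_gt0 (A y) (B j) _ _ _ _
    (fun q => (js == [::])%:R * g q) U P (y j) (A_bounded yc) (A_coercive yc)
    (cB_ge0 j) cF_ge0 (B_bounded j)
    (sum_of_forms_bounded Ul' (fun il => B_bounded il.1) _)
    (fun_derive_sum (fun il => B_bounded il.1) (fun il => cB_ge0 il.1)
       (fun v => (js == [::])%:R * f v) dUl).
  near=> t; have tc : open_cube [eta y with j |-> t] by near: t; exact: near_open_cube.
  have [e1 e2] := eq_js _ tc; split => // v.
  by rewrite -A_affine//; have := tc j; rewrite /= eqxx.
split; [exact: ex_derive|exact: ex_derive|].
have UE : partials (j :: js) u y = U' by rewrite /= /partial derive1E derive_val.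
have PE : partials (j :: js) p y = P' by rewrite /= /partial derive1E derive_val.
rewrite /partials_equation UE PE; split => [v|q]; last by rewrite bU' mul0r.
(* The head of [deletions (j :: js)] is the term with slope [B j]; the others come from
   differentiating the sum over [deletions js]. *)
rewrite eqU' /= mul0r sub0r big_cons big_map /= opprD addrC.
by rewrite /U with_same.
Unshelve. all: by end_near. Qed.

(** Induction on the length: the equation for a list comes from that for its tail, and
    differentiating it uses derivability only for lists shorter by one. *)
Lemma partials_solve js y : open_cube y ->
  [/\ partials_equation js y, derivable_at (partials js u) y & derivable_at (partials js p) y].
Proof.
have [n] := ubnP (size js); elim: n js y => [//|n IH] js y; rewrite ltnS => js_n.
have eq_js z : open_cube z -> partials_equation js z.
  case: js js_n => [_|j js js_n] zc.
    have [e1 e2] := up_solution zc.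
    split => [v|q]; last by rewrite mul1r e2.
    by rewrite /= big_nil mul1r subr0 e1.
  have [x xc||_ _] := @partials_equationS js _ _ z zc; last exact.
    by have [] := IH js x js_n xc.
  move=> il x /deletions_size js_il xc; have [|_ d_il _] := IH il.2 x _ xc; last exact: d_il.
  by move: js_n; rewrite /= js_il => /ltnW.
move=> yc; have eq_y := eq_js y yc.
have [|dU dP _] := partials_equationS eq_js _ yc; last by split.
move=> il x /deletions_size js_il xc; have [|_ d_il _] := IH il.2 x _ xc; last exact: d_il.
by move: js_n; rewrite js_il.
Qed.

Lemma ex_partials_of {W : normedModType R} (psi : (nat -> R) -> W) js y :
  (forall js y, open_cube y -> derivable_at (partials js psi) y) ->
  open_cube y -> ex_partials js psi y.
Proof.
move=> d_psi; elim: js y => [//|j js IH] y yc /=; split; last exact: d_psi.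
by apply: filterS (near_open_cube j yc) => t; exact: IH.
Qed.

Lemma ex_partials_solution js y : open_cube y -> ex_partials js u y /\ ex_partials js p y.
Proof.
by move=> yc; split; apply: ex_partials_of yc => ks z zc; have [] := partials_solve ks zc.
Qed.

End parametric_saddle_point.

(** * Multi-indices *)

Section multi_indices.
Implicit Types (nu mu : multi_index) (j J K : nat) (js : seq nat).

(** The multi-index [nu - e_j]. It equals [nu] when [nu j = 0], hence the guards [0 < nu j]
    below. *)
Definition pred_at nu j : multi_index := [fsfun nu with j |-> (nu j).-1].

Definition supported_below J nu : Prop := forall j, nu j != 0 -> (j < J)%N.

Lemma pred_atE nu j i : pred_at nu j i = if i == j then (nu j).-1 else nu i.
Proof. by rewrite fsfun_withE. Qed.

Lemma supported_below_ex nu : exists J, supported_below J nu.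
Proof.
exists (\max_(j <- finsupp nu) j.+1) => j; rewrite -mem_finsupp => jnu.
by rewrite (@leq_bigmax_seq _ _ _ (fun i => i.+1)).
Qed.

Lemma count_directions nu j : count_mem j (directions nu) = nu j.
Proof.
rewrite /directions count_flatten -map_comp sumnE big_map.
under eq_bigr do rewrite /= count_nseq.
rewrite (perm_big (finsupp nu)) /=; last by rewrite perm_sort.
case: (boolP (j \in finsupp nu)) => [jnu|].
  rewrite (big_fsetD1 j) //= eqxx mul1n big1_fset ?addn0// => i.
  by rewrite in_fsetD1 => /andP[/negPf ->].
rewrite mem_finsupp negbK => /eqP nuj; rewrite nuj big1_fset// => i ifs _.
by case: eqP => [ij|]; [rewrite ij nuj|rewrite mul0n].
Qed.

Lemma sorted_directions nu : sorted leq (directions nu).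
Proof.
rewrite /directions; have : sorted leq (sort leq (finsupp nu)).
  by apply: sort_sorted; exact: leq_total.
elim: (sort _ _) => [//|j s IH] /= js; rewrite -[sorted _ _]/(sorted leq (_ ++ _)).
rewrite sorted_pairwise; last exact: leq_trans.
rewrite pairwise_cat -!sorted_pairwise; try exact: leq_trans.
rewrite IH ?andbT; last by move: js; rewrite path_sortedE; [case/andP|exact: leq_trans].
apply/andP; split.
  apply/allrelP => i k /nseqP[-> _] /flatten_mapP[l ls /nseqP[-> _]].
  by move: js; rewrite path_sortedE; [case/andP => /allP/(_ _ ls)|exact: leq_trans].
by elim: (nu j) => [//|[|n] //= ->]; rewrite leqnn.
Qed.

Lemma directions_uniqueness nu js :
  sorted leq js -> (forall j, count_mem j js = nu j) -> js = directions nu.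
Proof.
move=> s_js c_js; apply: (sorted_eq leq_trans anti_leq s_js (sorted_directions nu)).
by apply/allP => j _ /=; rewrite c_js count_directions.
Qed.

Lemma directions_bounded J nu j : supported_below J nu -> j \in directions nu -> (j < J)%N.
Proof. by move=> + jd; apply; rewrite -lt0n -count_directions -has_count has_pred1. Qed.

Lemma deletionsP js il : il \in deletions js ->
  subseq il.2 js /\ perm_eq js (il.1 :: il.2).
Proof.
elim: js il => [//|j js IH] il; rewrite inE => /predU1P[->/=|/mapP[kl /IH[s p] ->]].
  by split; [exact: subseq_cons|exact: perm_refl].
split; first by rewrite /= eqxx.
apply: (@perm_trans _ (j :: kl.1 :: kl.2)); first by rewrite perm_cons.
exact/permPl/(perm_catCA [:: j] [:: kl.1]).
Qed.

Lemma map_deletions js : map fst (deletions js) = js.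
Proof. by elim: js => [//|j js IH] /=; rewrite -map_comp -[in RHS]IH. Qed.

(** Removing an entry keeps the list sorted, and a sorted list is determined by its counts. So the
    derivatives in the differentiated equation are taken in the very order that defines the Taylor
    coefficients. *)
Lemma deletions_directions nu il : il \in deletions (directions nu) ->
  il.2 = directions (pred_at nu il.1).
Proof.
move=> /deletionsP[sub_il perm_il]; apply: directions_uniqueness => [|j].
  exact: subseq_sorted leq_trans _ _ sub_il (sorted_directions nu).
have := count_directions nu j; rewrite (permP perm_il) /= pred_atE eq_sym.
case: eqP => [->|_]; last by rewrite add0n.
by have := count_directions nu il.1; rewrite (permP perm_il) /= eqxx add1n => <-.
Qed.

Lemma directions_pred_at nu j : (0 < nu j)%N ->
  perm_eq (directions nu) (j :: directions (pred_at nu j)).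
Proof.
move=> nuj; apply/allP => i _ /=; rewrite !count_directions pred_atE (eq_sym i).
by have [<-|_] := eqVneq j i; rewrite ?add0n//; case: (nu j) nuj.
Qed.

Lemma directions_eq0 nu : (directions nu == [::]) = (nu == [fsfun]).
Proof.
apply/eqP/eqP => [H|->].
  by apply/fsfunP => j; rewrite -count_directions H fsfunE.
by apply/esym/directions_uniqueness => // j; rewrite fsfunE.
Qed.

Lemma big_count (T : Type) (idx : T) (op : Monoid.com_law idx) (F : nat -> T) J js :
  (forall j, j \in js -> (j < J)%N) ->
  \big[op/idx]_(j <- js) F j = \big[op/idx]_(j < J) iter (count_mem (j : nat) js) (op (F j)) idx.
Proof.
move=> jsJ.
transitivity (\big[op/idx]_(j < J) \big[op/idx]_(i <- js | i == j) F i); last first.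
  apply: eq_bigr => j _; rewrite -big_const_seq.
  by apply: eq_big => // i /eqP ->.
rewrite (exchange_big_dep xpredT) //= big_seq [RHS]big_seq; apply: eq_bigr => i /jsJ iJ.
rewrite (big_pred1 (Ordinal iJ)) // => j; rewrite eq_sym; exact/eqP/eqP => [->|[]].
Qed.

Lemma sum_directions (Z : nmodType) (F : nat -> Z) J nu : supported_below J nu ->
  \sum_(j <- directions nu) F j = \sum_(j < J) F j *+ nu j.
Proof.
move=> nuJ; rewrite (@big_count _ _ _ _ J) => [|j]; last exact: directions_bounded.
by apply: eq_bigr => j _; rewrite count_directions iter_addr_0.
Qed.

Lemma prod_directions (Z : comPzRingType) (F : nat -> Z) J nu : supported_below J nu ->
  \prod_(j <- directions nu) F j = \prod_(j < J) F j ^+ nu j.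
Proof.
move=> nuJ; rewrite (@big_count _ _ _ _ J) => [|j]; last exact: directions_bounded.
by apply: eq_bigr => j _; rewrite count_directions iter_mulr_1.
Qed.

Lemma multi_factE J nu : supported_below J nu -> multi_fact nu = (\prod_(j < J) (nu j)`!)%N.
Proof.
move=> nuJ; rewrite /multi_fact -(big_mkord xpredT (fun j => (nu j)`!)).
transitivity (\prod_(i <- [seq i <- index_iota 0 J | i \in finsupp nu]) (nu i)`!)%N.
  apply: perm_big; apply: uniq_perm => [||i]; [exact: fset_uniq|exact/filter_uniq/iota_uniq|].
  rewrite mem_filter mem_index_iota; case: (boolP (i \in finsupp nu)) => //=.
  by rewrite mem_finsupp => /nuJ ->.
rewrite big_filter; apply: big_rmcond => i; rewrite mem_finsupp negbK => /eqP ->.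
exact: fact0.
Qed.

Lemma supported_below_pred_at J nu j : supported_below J nu -> supported_below J (pred_at nu j).
Proof.
move=> nuJ i; rewrite pred_atE; have [->|_] := eqVneq i j; last exact: nuJ.
by case: (nu j) (nuJ j) => // n H _; apply: H.
Qed.

Lemma multi_fact_pred_at nu j : (0 < nu j)%N ->
  multi_fact nu = (nu j * multi_fact (pred_at nu j))%N.
Proof.
move=> nuj; have [J nuJ] := supported_below_ex nu.
have jJ : (j < J)%N by apply: nuJ; rewrite -lt0n.
rewrite (multi_factE nuJ) (multi_factE (@supported_below_pred_at _ _ j nuJ)).
rewrite (bigD1 (Ordinal jJ)) //= [in RHS](bigD1 (Ordinal jJ)) //= mulnA.
rewrite pred_atE eqxx; congr (_ * _)%N; first by case: (nu j) nuj => // n _; rewrite factS.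
apply: eq_bigr => i; rewrite pred_atE; have [ij|//] := eqVneq (i : nat) j.
by rewrite -val_eqE /= ij eqxx.
Qed.

Definition multi_of_ffun J K (h : {ffun 'I_J -> 'I_K.+1}) : multi_index :=
  [fsfun j in seq_fset tt (iota 0 J) => oapp (fun i : 'I_J => h i : nat) 0%N (insub j)].

Lemma multi_of_ffunE J K (h : {ffun 'I_J -> 'I_K.+1}) j :
  multi_of_ffun h j = oapp (fun i : 'I_J => h i : nat) 0%N (insub j).
Proof.
rewrite fsfunE seq_fsetE mem_iota /= add0n; case: insubP => [i -> //|].
by move=> /negPf ->.
Qed.

Lemma multi_of_ffun_ord J K (h : {ffun 'I_J -> 'I_K.+1}) (i : 'I_J) :
  multi_of_ffun h i = h i.
Proof. by rewrite multi_of_ffunE valK. Qed.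

(** Listing the box through finite functions lets sums of products over it factor by
    distributivity. *)
Definition multi_box J K : seq multi_index :=
  [seq multi_of_ffun h | h : {ffun 'I_J -> 'I_K.+1}].

Lemma multi_boxP J K nu : reflect (supported_below J nu /\ forall j, (nu j <= K)%N)
  (nu \in multi_box J K).
Proof.
apply: (iffP mapP) => [[h _ ->]|[nuJ nuK]].
  split => j; rewrite multi_of_ffunE; case: insubP => //= i _ _.
  by rewrite -ltnS.
exists [ffun i : 'I_J => inord (nu i)]; first by rewrite mem_enum.
apply/fsfunP => j.
rewrite multi_of_ffunE; case: insubP => /= [i jJ <-|].
  by rewrite ffunE inordK// ltnS.
by apply: contraNeq; exact: nuJ.
Qed.

Lemma multi_box_uniq J K : uniq (multi_box J K).
Proof.
rewrite map_inj_uniq ?enum_uniq// => h h' hh'; apply/ffunP => i; apply: val_inj.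
by rewrite /= -!multi_of_ffun_ord hh'.
Qed.

Lemma multi_box_pred_at J K nu j : nu \in multi_box J K -> pred_at nu j \in multi_box J K.
Proof.
move=> /multi_boxP[nuJ nuK]; apply/multi_boxP; split; first exact: supported_below_pred_at.
by move=> i; rewrite pred_atE; case: eqP => // _; apply: leq_trans (leq_pred _) (nuK j).
Qed.

Lemma multi_box_ex (s : seq multi_index) : exists J K, {subset s <= multi_box J K}.
Proof.
elim: s => [|nu s [J [K sJK]]]; first by exists 0%N, 0%N.
have [J' nuJ'] := supported_below_ex nu.
exists (maxn J J'), (maxn K (\max_(j < J') nu j)) => mu.
rewrite inE => /predU1P[->|/sJK/multi_boxP[muJ muK]]; apply/multi_boxP; split => j.
- by move=> /nuJ' j'; rewrite leq_max j' orbT.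
- have [->//|/nuJ' jJ'] := eqVneq (nu j) 0%N.
  by rewrite leq_max (@leq_bigmax _ (fun i : 'I_J' => nu i : nat) (Ordinal jJ')) orbT.
- by move=> /muJ jJ; rewrite leq_max jJ.
- by rewrite leq_max muK.
Qed.

Lemma pred_at_inj j : {in [pred nu : multi_index | (0 < nu j)%N] &, injective (pred_at ^~ j)}.
Proof.
move=> nu mu; rewrite !inE => nuj muj /fsfunP H; apply/fsfunP => i.
have := H i; rewrite !pred_atE; case: eqP => // ->.
by case: (nu j) (mu j) nuj muj => [//|n] [//|m] _ _ /= ->.
Qed.

Lemma pred_at_inj_index nu :
  {in [pred j | (0 < nu j)%N] &, injective (pred_at nu)}.
Proof.
move=> i j; rewrite !inE => nui nuj /fsfunP/(_ i); rewrite !pred_atE eqxx.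
by case: eqP => // _; case: (nu i) nui => // n _ /eqP; rewrite /= ltn_eqF.
Qed.

End multi_indices.

(** The image of an injection picks out some terms of a nonnegative sum. This serves for
    [nu |-> nu - e_j] with [j] fixed, for [j |-> nu - e_j] with [nu] fixed, and for enlarging a
    finite set to a box. *)
Lemma ler_sum_inj {R : numDomainType} (I J : eqType) (r : seq I) (s : seq J) (P : pred I)
    (h : I -> J) (G : J -> R) :
  uniq r -> {in P &, injective h} -> uniq s -> (forall i, i \in r -> P i -> h i \in s) ->
  (forall j, 0 <= G j) ->
  \sum_(i <- r | P i) G (h i) <= \sum_(j <- s) G j.
Proof.
move=> r_uniq h_inj s_uniq hs G0; rewrite -big_filter -(big_map h xpredT).
set t := map h _.
have -> : \sum_(i <- t) G i = \sum_(j <- s | j \in t) G j.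
  rewrite -[RHS]big_filter; apply: perm_big; apply: uniq_perm.
  - rewrite map_inj_in_uniq ?filter_uniq// => i k.
    by rewrite !mem_filter => /andP[Pi _] /andP[Pk _]; exact: h_inj.
  - exact: filter_uniq.
  - move=> j; rewrite mem_filter; case: (boolP (j \in t)) => //= /mapP[i].
    by rewrite mem_filter => /andP[Pi ir] ->; rewrite hs.
rewrite [leRHS](bigID (mem t)) /= lerDl; exact: sumr_ge0.
Qed.

(** * Weighted estimates of the Taylor coefficients *)

Section Taylor_equation.
Context {R : realType} {V Q : completeNormedModType R}.
Context (b : {bilinear V -> Q -> R | *%R & *%R}).
Context (A : (nat -> R) -> {biscalar V}) (B : nat -> {biscalar V}).
Context (f : V -> R) (g : Q -> R) (u : (nat -> R) -> V) (p : (nat -> R) -> Q).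

(** The differentiated equation is divided by [nu!]. The direction [j] is deleted [nu j] times, and
    [nu_j / nu! = 1 / (nu - e_j)!]. *)
Lemma Taylor_coef_equation nu J :
  partials_equation b A B f g u p (directions nu) (fun=> 0) ->
  nu != [fsfun] -> supported_below J nu ->
  saddle_point_solution (A (fun=> 0)) b
    (fun v => - \sum_(j < J | (0 < nu j)%N) B j (Taylor_coef u (pred_at nu j)) v)
    (fun=> 0) (Taylor_coef u nu) (Taylor_coef p nu).
Proof.
rewrite /partials_equation directions_eq0 => + nu0 nuJ; rewrite (negPf nu0) => -[e1 e2].
split => [v|q]; last by rewrite (formZl b) e2 mul0r mulr0.
rewrite (formZl (A _)) (formZr b) -mulrDr e1 mul0r sub0r mulrN; congr (- _).
have -> : \sum_(il <- deletions (directions nu)) B il.1 (partials il.2 u (fun=> 0)) v =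
    \sum_(j <- directions nu) B j (partials (directions (pred_at nu j)) u (fun=> 0)) v.
  rewrite -[in RHS](map_deletions (directions nu)) big_map !big_seq.
  by apply: eq_bigr => il /deletions_directions ->.
rewrite (sum_directions _ nuJ) mulr_sumr [RHS]big_mkcond; apply: eq_bigr => j _.
case: posnP => [->|nuj]; first by rewrite mulr0n mulr0.
rewrite (formZl (B j)) -(mulr_natl (B j _ _)) mulrA (multi_fact_pred_at nuj) natrM invfM.
by rewrite [X in X * _]mulrAC mulVf ?mul1r// pnatr_eq0 -lt0n.
Qed.

End Taylor_equation.

(** * Square-sum and uniform bounds from the recursion of the coefficients *)

Section weighted_estimates.
Implicit Types nu mu : multi_index.
Context {R : realType} {V Q : completeNormedModType R}.
Context (b : {bilinear V -> Q -> R | *%R & *%R}) (beta gamma alpha M : R).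
Context (beta_gt0 : 0 < beta) (gamma_gt0 : 0 < gamma) (alpha_gt0 : 0 < alpha).
Context (b_inf_sup : (beta%:E <= inf_sup b)%E).
Context (A0 : {biscalar V}) (B : nat -> {biscalar V}) (m : nat -> V -> R) (rho : nat -> R).
Context (M_ge0 : 0 <= M).
Context (A0_bounded : form_bounded A0 gamma).
Context (m_young : forall j w v, `|rho j * B j w v| <= 2^-1 * (m j w + m j v)).
Context (m_sum : forall J (I : pred nat) v, \sum_(j < J | I j) m j v <= M * `|v| ^+ 2).
Context (m_ge0 : forall j v, kernel_form b v -> 0 <= m j v).
Context (m_kernel : forall J v, kernel_form b v ->
  \sum_(j < J) m j v <= A0 v v - alpha * `|v| ^+ 2).
Context (tu : multi_index -> V) (tp : multi_index -> Q).
Context (t_equation : forall nu J, nu != [fsfun] -> supported_below J nu ->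
  saddle_point_solution A0 b
    (fun v => - \sum_(j < J | (0 < nu j)%N) B j (tu (pred_at nu j)) v)
    (fun=> 0) (tu nu) (tp nu)).

(** The number [rho^nu], written over the list of directions so that removing a direction removes a
    factor. *)
Definition weight (nu : multi_index) : R := \prod_(j <- directions nu) rho j.

Let wu nu := weight nu *: tu nu.
Let wp nu := weight nu *: tp nu.

Lemma weight_pred_at nu j : (0 < nu j)%N -> weight nu = rho j * weight (pred_at nu j).
Proof. by move=> nuj; rewrite /weight (perm_big _ (directions_pred_at nuj)) big_cons. Qed.

Let w_equation nu J : nu != [fsfun] -> supported_below J nu ->
  saddle_point_solution A0 b
    (fun v => - \sum_(j < J | (0 < nu j)%N) rho j * B j (wu (pred_at nu j)) v)
    (fun=> 0) (wu nu) (wp nu).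
Proof.
move=> nu0 nuJ; have [e1 e2] := t_equation nu0 nuJ.
split => [v|q]; last by rewrite (formZl b) e2 mulr0.
rewrite (formZl A0) (formZr b) -mulrDr e1 mulrN mulr_sumr; congr (- _).
apply: eq_bigr => j nuj; rewrite (formZl (B j)) mulrA -weight_pred_at//.
Qed.

(** Nothing places [wu [fsfun]] in the kernel of [b], and off the kernel [m j] may be negative.
    Positive parts allow sums to be enlarged freely and change nothing on the kernel. *)
Let mp j v := Num.max 0 (m j v).

Let mp_ge0 j v : 0 <= mp j v. Proof. by rewrite /mp le_max lexx. Qed.

(** The positive parts sum up [m j v] over the [j] where it is nonnegative; this is why [m_sum]
    allows a subset [I] of indices. *)
Let mp_sum J v : \sum_(j < J) mp j v <= M * `|v| ^+ 2.
Proof.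
apply: le_trans (m_sum J (fun j => 0 <= m j v) v); rewrite [leRHS]big_mkcond.
apply: ler_sum => j _; rewrite /mp; case: ifPn => [/max_idPr -> //|].
by rewrite -ltNge => /ltW/max_idPl ->.
Qed.

Let mp_kernel J v : kernel_form b v -> \sum_(j < J) mp j v <= A0 v v - alpha * `|v| ^+ 2.
Proof.
move=> bv; apply: le_trans (m_kernel J bv).
by apply: ler_sum => j _; rewrite /mp (max_idPr _)// m_ge0.
Qed.

Let young_sum nu J v :
  `|- \sum_(j < J | (0 < nu j)%N) rho j * B j (wu (pred_at nu j)) v| <=
  2^-1 * (\sum_(j < J | (0 < nu j)%N) mp j (wu (pred_at nu j)) + \sum_(j < J) mp j v).
Proof.
rewrite normrN; apply: le_trans (ler_norm_sum _ _ _) _.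
apply: (@le_trans _ _ (\sum_(j < J | (0 < nu j)%N)
    2^-1 * (mp j (wu (pred_at nu j)) + mp j v))).
  apply: ler_sum => j _; apply: le_trans (m_young _ _ _) _.
  by rewrite ler_wpM2l ?invr_ge0// lerD// /mp le_max lexx orbT.
rewrite -mulr_sumr big_split ler_wpM2l ?invr_ge0//= lerD2l.
by rewrite [leLHS]big_mkcond; apply: ler_sum => j _; case: ifP.
Qed.

Let kernel_wu nu : nu != [fsfun] -> kernel_form b (wu nu).
Proof.
by move=> nu0 q; have [J nuJ] := supported_below_ex nu; have [_ ->] := w_equation nu0 nuJ.
Qed.

Let C0 := M * `|wu [fsfun]| ^+ 2.

Let C0_ge0 : 0 <= C0. Proof. by rewrite mulr_ge0// exprn_ge0. Qed.

(* Testing the equation for [wu nu] with [wu nu] gives, by Young's inequality,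
   [A0 w w + alpha |w|^2 <= \sum_j mp j (wu (nu - e_j))]. Summed over a box, the right-hand
   side is at most [\sum_mu \sum_j mp j (wu mu)], hence [\sum (A0 w w - alpha |w|^2)] up to the
   term [mu = 0], and the sums of [A0 w w] cancel. *)
Lemma weighted_l2_bound J K :
  \sum_(nu <- multi_box J K | nu != [fsfun]) `|wu nu| ^+ 2 <= C0 / (2 * alpha).
Proof.
have test nu : nu \in multi_box J K -> nu != [fsfun] ->
    A0 (wu nu) (wu nu) + alpha * `|wu nu| ^+ 2 <=
    \sum_(j < J | (0 < nu j)%N) mp j (wu (pred_at nu j)).
  move=> /multi_boxP[nuJ _] nu0; have [e1 _] := w_equation nu0 nuJ.
  have := e1 (wu nu); rewrite (kernel_wu nu0) addr0.
  have := young_sum nu J (wu nu); have := mp_kernel J (kernel_wu nu0).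
  by rewrite ler_norml => ? /andP[_ ?] ?; lra.
(* For fixed [j], [nu |-> nu - e_j] is injective where [0 < nu j] and stays in the box; after
   exchanging the sums, each shifted sum is part of the full one. *)
have shift : \sum_(nu <- multi_box J K | nu != [fsfun])
      \sum_(j < J | (0 < nu j)%N) mp j (wu (pred_at nu j)) <=
    \sum_(mu <- multi_box J K) \sum_(j < J) mp j (wu mu).
  rewrite (exchange_big_dep xpredT) //= [leRHS]exchange_big /=; apply: ler_sum => j _.
  apply: le_trans (_ : \sum_(nu <- multi_box J K | (0 < nu j)%N) mp j (wu (pred_at nu j)) <= _).
    rewrite big_mkcond [leRHS]big_mkcond; apply: ler_sum => nu _.
    by case: ifP => [/andP[_ ->]|_] //; case: ifP.
  apply: (@ler_sum_inj _ _ _ _ _ (fun nu : multi_index => (0 < nu j)%N) (fun nu => pred_at nu j)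
      (fun mu => mp j (wu mu))) => //.
  - exact: multi_box_uniq.
  - exact: pred_at_inj.
  - exact: multi_box_uniq.
  - by move=> nu nuJK _; exact: multi_box_pred_at.
have total : \sum_(mu <- multi_box J K) \sum_(j < J) mp j (wu mu) <=
    C0 + \sum_(nu <- multi_box J K | nu != [fsfun]) (A0 (wu nu) (wu nu) - alpha * `|wu nu| ^+ 2).
  rewrite (bigD1_seq [fsfun]) ?multi_box_uniq//=; last first.
    by apply/multi_boxP; split => j; rewrite fsfunE.
  apply: lerD; first exact: mp_sum.
  by apply: ler_sum => nu nu0; exact/mp_kernel/kernel_wu.
have : \sum_(nu <- multi_box J K | nu != [fsfun])
      (A0 (wu nu) (wu nu) + alpha * `|wu nu| ^+ 2) <=
    \sum_(nu <- multi_box J K | nu != [fsfun])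
      \sum_(j < J | (0 < nu j)%N) mp j (wu (pred_at nu j)).
  by rewrite big_seq_cond [leRHS]big_seq_cond; apply: ler_sum => nu /andP[]; exact: test.
move: total; rewrite sumrB big_split /= -!mulr_sumr => h1 h2.
rewrite ler_pdivlMr ?mulr_gt0//; lra.
Qed.

Lemma weighted_l2_bounded : exists C, forall J K,
  \sum_(nu <- multi_box J K) `|weight nu *: tu nu| ^+ 2 <= C.
Proof.
exists (`|wu [fsfun]| ^+ 2 + C0 / (2 * alpha)) => J K.
rewrite (bigD1_seq [fsfun]) ?multi_box_uniq//=; last first.
  by apply/multi_boxP; split => j; rewrite fsfunE.
by rewrite lerD2l weighted_l2_bound.
Qed.

(** For fixed [nu] the indices [nu - e_j] are distinct, so the square-sum bound controls the
    right-hand side of the equation uniformly in [nu]; the inf-sup condition passes this on to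
    [wp nu]. *)
Lemma weighted_sup_bounded : exists C, forall nu, `|weight nu *: tp nu| <= C.
Proof.
have [C HC] := weighted_l2_bounded.
have C_ge0 : 0 <= C by apply: le_trans (HC 0%N 0%N); apply: sumr_ge0 => nu _; exact: exprn_ge0.
(* The first term bounds [A0 (wu nu) z] for unit [z], the second is Young's bound of the right-hand
   side. *)
pose C' := gamma * (C + 1) + 2^-1 * (M * C + M).
have C'_ge0 : 0 <= C'.
  by rewrite addr_ge0// mulr_ge0 ?addr_ge0 ?invr_ge0 ?mulr_ge0// ltW.
exists (`|wp [fsfun]| + beta^-1 * C') => nu.
have [->|nu0] := eqVneq nu [fsfun]; first by rewrite lerDl mulr_ge0// invr_ge0 ltW.
suff : `|wp nu| <= beta^-1 * C' by move=> /le_trans; apply; rewrite lerDr.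
rewrite ler_pdivlMl//; apply: inf_sup_le => // [|v]; first exact: b_inf_sup.
have [J [K /(_ nu)]] := multi_box_ex [:: nu]; rewrite inE eqxx => /(_ isT) nuJK.
have nuJ : supported_below J nu by have [] := multi_boxP _ _ _ nuJK.
have [e1 _] := w_equation nu0 nuJ.
(* Young's bound is not homogeneous in the test function, so it is used on unit vectors and rescaled
   afterwards. *)
have one z : `|z| = 1 -> b z (wp nu) <= C'.
  move=> z1; have := e1 z; have := young_sum nu J z; have := form_bounded_norm (wu nu) z A0_bounded.
  have := mp_sum J z; rewrite z1 expr1n !mulr1.
  have : `|wu nu| <= C + 1.
    have : `|wu nu| ^+ 2 <= C.
      apply: le_trans (HC J K); rewrite (bigD1_seq nu) ?multi_box_uniq//= lerDl.
      by apply: sumr_ge0 => mu _; exact: exprn_ge0.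
    (* With [x = |wu nu|], [0 <= (x - 1)^2] gives [2 x <= x^2 + 1 <= C + 1]. *)
    have := sqr_ge0 (`|wu nu| - 1); rewrite sqrrB1 => h1 h2.
    by have : 0 <= `|wu nu| := normr_ge0 _; lra.
  have : \sum_(j < J | (0 < nu j)%N) mp j (wu (pred_at nu j)) <= M * C.
    apply: (@le_trans _ _ (\sum_(j < J | (0 < nu j)%N) M * `|wu (pred_at nu j)| ^+ 2)).
      apply: ler_sum => j _; apply: le_trans (mp_sum J _).
      by rewrite (bigD1 j) //= lerDl; apply: sumr_ge0.
    rewrite -mulr_sumr ler_wpM2l//; apply: le_trans (HC J K).
    apply: (@ler_sum_inj _ _ _ _ _ (fun j : 'I_J => (0 < nu j)%N) (fun j : 'I_J => pred_at nu j)
      (fun mu => `|wu mu| ^+ 2)).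
    - exact: index_enum_uniq.
    - by move=> i j nui nuj /pred_at_inj_index ij; apply/val_inj/ij.
    - exact: multi_box_uniq.
    - by move=> j _ _; exact: multi_box_pred_at.
    - by move=> mu; exact: exprn_ge0.
  rewrite !ler_norml => ? h ? /andP[? ?] /andP[? ?] ?.
  have : gamma * `|wu nu| <= gamma * (C + 1) by rewrite ler_wpM2l// ltW.
  by rewrite /C'; lra.
have [->|v0] := eqVneq v 0; first by rewrite normr0 mulr0 (form0l b).
have v_gt0 : 0 < `|v| by rewrite normr_gt0.
rewrite -ler_pdivrMr// mulrC -(formZl b); apply: one.
by rewrite normrZ ger0_norm ?invr_ge0// mulVf// gt_eqF.
Qed.

End weighted_estimates.

(** * Summability over multi-indices *)

Section summability.
Context {R : realType}.
Implicit Types (nu : multi_index) (r rho : nat -> R).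

(** Every finite set of multi-indices lies in a box, so a bound over all boxes suffices. *)
Lemma esum_multi_lt_pinfty (F : multi_index -> R) C :
  (forall nu, 0 <= F nu) -> (forall J K, \sum_(nu <- multi_box J K) F nu <= C) ->
  (\esum_(nu in [set: multi_index]) (F nu)%:E < +oo)%E.
Proof.
move=> F0 FC; apply: (@le_lt_trans _ _ C%:E); last exact: ltry.
apply: ge_ereal_sup => _ [X [finX _] <-].
rewrite fsbig_finite//= sumEFin lee_fin; have [J [K XJK]] := multi_box_ex (fset_set X).
apply: le_trans (FC J K); apply: (@ler_sum_inj _ _ _ _ _ xpredT id F) => //.
- exact: fset_uniq.
- exact: multi_box_uniq.
- by move=> nu nuX _; exact: XJK.
Qed.

(** The terms of a convergent series are eventually below [2^-1]; [q] is the maximum of [2^-1] and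
    the finitely many earlier terms. *)
Lemma bounded_away_from1 r : (forall j, 0 <= r j < 1) ->
  (\sum_(0 <= j <oo) (r j)%:E < +oo)%E ->
  exists S q, [/\ q < 1, forall j, r j <= q & forall J, \sum_(j < J) r j <= S].
Proof.
move=> r01; set S := (\sum_(0 <= j <oo) (r j)%:E)%E => S_fin.
have r0 j : 0 <= r j by have /andP[] := r01 j.
have rS J : \sum_(j < J) r j <= fine S.
  rewrite -lee_fin fineK; last first.
    by rewrite ge0_fin_numE//; apply: nneseries_ge0 => j _ _; rewrite lee_fin.
  rewrite -sumEFin -(big_mkord xpredT (fun j => (r j)%:E)).
  by apply: nneseries_lim_ge => j _ _; rewrite lee_fin.
have : cvgn (series r).
  apply: nondecreasing_is_cvgn; first by apply: nondecreasing_series => j _ _.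
  by exists (fine S) => _ [J _ <-]; rewrite /series /= big_mkord.
move=> /cvg_series_cvg_0/cvgrPdist_lt/(_ 2^-1); rewrite invr_gt0 => /(_ (ltr0Sn _ _)) [N _ HN].
exists (fine S), (\big[Num.max/2^-1]_(j < N) r j); split => //.
- elim/big_ind : _ => [|x y x1 y1|j _]; first by rewrite invf_lt1// ltr1n.
    by rewrite gt_max x1.
  by have /andP[] := r01 j.
- move=> j; have [jN|Nj] := ltnP j N.
    exact: (le_bigmax _ (fun j : 'I_N => r j) (Ordinal jN)).
  apply: (@le_trans _ _ 2^-1).
    by have := HN _ Nj; rewrite /= sub0r normrN ger0_norm// => /ltW.
  exact: bigmax_ge_id.
Qed.

Lemma sum_multi_box J K r :
  \sum_(nu <- multi_box J K) \prod_(j <- directions nu) r j =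
  \prod_(j < J) \sum_(k < K.+1) r j ^+ k.
Proof.
rewrite bigA_distr_bigA /multi_box big_map big_enum /=; apply: eq_bigr => h _.
rewrite (@prod_directions _ _ J).
  by apply: eq_bigr => j _; rewrite multi_of_ffun_ord.
have : multi_of_ffun h \in multi_box J K by apply: map_f; rewrite mem_enum.
by case/multi_boxP.
Qed.

Lemma geometric_le (x : R) n : 0 <= x < 1 -> \sum_(k < n) x ^+ k <= (1 - x)^-1.
Proof.
move=> /andP[x0 x1]; rewrite -[leRHS]mul1r ler_pdivlMr ?subr_gt0// mulrC.
by rewrite -[_ * _]opprK -mulNr opprB -subrX1 opprB lerBlDr lerDl exprn_ge0.
Qed.

(** Each factor of the product is at most [1 / (1 - r j) = 1 + r j / (1 - r j) <= exp (r j / (1 -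
    q))], and the exponents have bounded sums. *)
Lemma multi_geometric_bounded r : (forall j, 0 <= r j < 1) ->
  (\sum_(0 <= j <oo) (r j)%:E < +oo)%E ->
  exists C, forall J K, \sum_(nu <- multi_box J K) \prod_(j <- directions nu) r j <= C.
Proof.
move=> r01 /(bounded_away_from1 r01)[S [q [q1 rq rS]]].
have c_gt0 : 0 < (1 - q)^-1 by rewrite invr_gt0 subr_gt0.
exists (expR ((1 - q)^-1 * S)) => J K; rewrite sum_multi_box.
apply: (@le_trans _ _ (\prod_(j < J) expR ((1 - q)^-1 * r j))).
  apply: ler_prod => j _; have /andP[r0 r1] := r01 j.
  rewrite sumr_ge0/=; last by move=> k _; exact: exprn_ge0.
  apply: le_trans (geometric_le _ (r01 j)) _; apply: le_trans (expR_ge1Dx _).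
  have r1' : 0 < 1 - r j by rewrite subr_gt0.
  have -> : (1 - r j)^-1 = 1 + (1 - r j)^-1 * r j.
    by apply: (mulfI (lt0r_neq0 r1')); rewrite mulrDr mulrA divff ?gt_eqF//; ring.
  rewrite lerD2l ler_wpM2r// lef_pV2 ?posrE ?subr_gt0// lerD2l lerN2.
  exact: rq.
by rewrite -expR_sum -mulr_sumr ler_expR ler_wpM2l// ltW.
Qed.

Lemma weight_gt0 rho nu : (forall j, 0 < rho j) -> 0 < weight rho nu.
Proof. by move=> rho0; apply: prodr_gt0. Qed.

Lemma weightV_powR rho t nu : (forall j, 0 < rho j) ->
  (weight rho nu)^-1 `^ t = \prod_(j <- directions nu) `|(rho j)^-1| `^ t.
Proof.
move=> rho0; rewrite /weight; elim: (directions nu) => [|j js IH].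
  by rewrite !big_nil invr1 powR1.
rewrite !big_cons invfM powRM ?invr_ge0 ?IH ?ltW//; last by apply: prodr_gt0.
by rewrite ger0_norm// invr_ge0 ltW.
Qed.

Section weighted.
Context (rho : nat -> R) (rho_gt1 : forall j, 1 < rho j) (t : R) (t_gt0 : 0 < t).
Context (rho_summable : (\sum_(0 <= j <oo) (`|(rho j)^-1| `^ t)%:E < +oo)%E).

Let rho_gt0 j : 0 < rho j. Proof. exact: lt_trans (rho_gt1 j). Qed.

Lemma weightV_summable : exists C, forall J K,
  \sum_(nu <- multi_box J K) (weight rho nu)^-1 `^ t <= C.
Proof.
have [j|C HC] := @multi_geometric_bounded (fun j => `|(rho j)^-1| `^ t) _ rho_summable.
  rewrite powR_ge0 /=; have -> : 1 = 1 `^ t by rewrite powR1.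
  rewrite gt0_ltr_powR ?nnegrE//.
  by rewrite ger0_norm ?invr_ge0 ?invf_lt1// ltW.
exists C => J K; apply: le_trans (HC J K).
by under eq_bigr do rewrite weightV_powR//.
Qed.

Context {W : normedModType R} (c : multi_index -> W).

Lemma weighted_l2_summable C :
  (forall J K, \sum_(nu <- multi_box J K) `|weight rho nu *: c nu| ^+ 2 <= C) ->
  (\esum_(nu in [set: multi_index]) (`|c nu| `^ (2 * t / (2 + t)))%:E < +oo)%E.
Proof.
move=> HC; have [C' HC'] := weightV_summable; set s := 2 * t / (2 + t).
apply: (@esum_multi_lt_pinfty _ (C + C')) => [nu|J K]; first exact: powR_ge0.
apply: le_trans (lerD (HC J K) (HC' J K)); rewrite -big_split /=.
apply: ler_sum => nu _; have w_gt0 := weight_gt0 nu rho_gt0.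
have t2_gt0 : 0 < 2 + t by rewrite addr_gt0.
have s_gt0 : 0 < s by rewrite divr_gt0// mulr_gt0.
have -> : `|c nu| = `|weight rho nu *: c nu| * (weight rho nu)^-1.
  by rewrite normrZ gtr0_norm// mulrAC divff ?mul1r// gt_eqF.
rewrite powRM// ?invr_ge0 ?(ltW w_gt0)//.
(* The conjugate exponents are [2 / s] and [t / s]; they turn the two factors into a square and a
   power [t]. *)
have p_gt0 : 0 < (2 + t) / t by rewrite divr_gt0.
have q_gt0 : 0 < (2 + t) / 2 by rewrite divr_gt0.
have t0 : t != 0 by rewrite gt_eqF.
have t20 : 2 + t != 0 by rewrite gt_eqF.
apply: le_trans (@conjugate_powR _ _ _ _ _ (powR_ge0 _ _) (powR_ge0 _ _) p_gt0 q_gt0 _) _.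
  by field; rewrite t0 t20.
rewrite -!powRrM.
have -> : s * ((2 + t) / t) = 2%:R by rewrite /s; field; rewrite t0 t20.
have -> : s * ((2 + t) / 2) = t by rewrite /s; field.
(* Young's inequality divides each power by its exponent; both exponents are at least 1. *)
rewrite powR_mulrn//; apply: lerD; apply: ler_piMr; rewrite ?exprn_ge0 ?powR_ge0//.
  by rewrite invf_le1// ler_pdivlMr// mul1r lerDr.
by rewrite invf_le1// ler_pdivlMr// mul1r lerDl ltW.
Qed.

Lemma weighted_sup_summable C : (forall nu, `|weight rho nu *: c nu| <= C) ->
  (\esum_(nu in [set: multi_index]) (`|c nu| `^ t)%:E < +oo)%E.
Proof.
move=> HC; have [C' HC'] := weightV_summable.
have C_ge0 : 0 <= C := le_trans (normr_ge0 _) (HC [fsfun]).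
apply: (@esum_multi_lt_pinfty _ (C `^ t * C')) => [nu|J K]; first exact: powR_ge0.
apply: le_trans (ler_wpM2l (powR_ge0 _ _) (HC' J K)); rewrite mulr_sumr.
apply: ler_sum => nu _; have w_gt0 := weight_gt0 nu rho_gt0.
rewrite -powRM// ?invr_ge0 ?(ltW w_gt0)//; apply: ge0_ler_powR; rewrite ?nnegrE//.
- exact: ltW.
- by rewrite mulr_ge0// invr_ge0 ltW.
- by rewrite ler_pdivlMr// mulrC -(gtr0_norm w_gt0) -normrZ.
Qed.

End weighted.

End summability.

(** * Coefficients bounded on the domain *)

Section bounded_coefficients.
Context {R : realType} {d : nat} (D : set 'rV[R]_d.+1).
Implicit Types kappa : 'rV[R]_d.+1 -> R.

(** The bound is pointwise rather than essential, like the weight condition and the range of the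
    affine coefficient. *)
Definition bounded_coef kappa : Prop :=
  measurable_fun (D : set (Rleb R d)) (kappa : Rleb R d -> R) /\
  exists M, forall x, D x -> `|kappa x| <= M.

Lemma ess_sup_on_le kappa M : (forall x, D x -> `|kappa x| <= M) ->
  (ess_sup_on D (absf kappa) <= M%:E)%E.
Proof.
move=> kM; apply/ess_supP; apply: aeW => x; rewrite /patch.
by case: ifPn => [xD|_]; [rewrite lee_fin kM//; exact/set_mem|rewrite leNye].
Qed.

Lemma ess_inf_on_ge0 kappa : (forall x, D x -> 0 <= kappa x) ->
  (0 <= ess_inf_on D kappa)%E.
Proof.
move=> k0; apply/ess_infP; apply: aeW => x; rewrite /patch.
by case: ifPn => [xD|_]; [rewrite lee_fin k0//; exact/set_mem|rewrite leey].
Qed.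

Lemma bounded_coef_Linfty kappa : bounded_coef kappa -> Linfty_on D kappa.
Proof.
by move=> [mk [M kM]]; split => //; apply: le_lt_trans (ess_sup_on_le kM) (ltry _).
Qed.

Lemma bounded_coef_cst c : bounded_coef (fun=> c).
Proof. by split; [exact: measurable_cst|exists `|c|]. Qed.

Lemma bounded_coef_linear c kappa kappa' : bounded_coef kappa -> bounded_coef kappa' ->
  bounded_coef (fun x => c * kappa x + kappa' x).
Proof.
move=> [mk [M kM]] [mk' [M' kM']]; split.
  exact: (measurable_funD (measurable_funM (measurable_cst c) mk) mk').
exists (`|c| * M + M') => x Dx; apply: le_trans (ler_normD _ _) _.
by rewrite lerD ?kM'// normrM ler_wpM2l ?kM.
Qed.

Lemma bounded_coefZ c kappa : bounded_coef kappa -> bounded_coef (fun x => c * kappa x).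
Proof.
move=> bk; rewrite (_ : (fun x => _) = fun x => c * kappa x + 0); last first.
  by apply/funext => x; rewrite addr0.
exact/bounded_coef_linear/bounded_coef_cst.
Qed.

Lemma bounded_coefD kappa kappa' : bounded_coef kappa -> bounded_coef kappa' ->
  bounded_coef (fun x => kappa x + kappa' x).
Proof.
move=> bk bk'; rewrite (_ : (fun x => _) = fun x => 1 * kappa x + kappa' x); last first.
  by apply/funext => x; rewrite mul1r.
exact: bounded_coef_linear.
Qed.

Lemma bounded_coef_norm kappa : bounded_coef kappa -> bounded_coef (fun x => `|kappa x|).
Proof.
move=> [mk [M kM]]; split; last by exists M => x Dx; rewrite normr_id kM.
exact: measurableT_comp.
Qed.

Lemma bounded_coef_sum (I : Type) (r : seq I) (P : pred I) (k : I -> 'rV[R]_d.+1 -> R) :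
  (forall i, bounded_coef (k i)) -> bounded_coef (fun x => \sum_(i <- r | P i) k i x).
Proof.
move=> bk; elim: r => [|i r IH].
  rewrite (_ : (fun x => _) = fun=> 0); first exact: bounded_coef_cst.
  by apply/funext => x; rewrite big_nil.
rewrite (_ : (fun x => _) = fun x =>
    (if P i then k i x else 0) + \sum_(i <- r | P i) k i x).
  by apply: bounded_coefD IH; case: (P i); [exact: bk|exact: bounded_coef_cst].
by apply/funext => x; rewrite big_cons; case: (P i); rewrite ?add0r.
Qed.

End bounded_coefficients.

(** * Dependence of the form on its coefficient *)

Section coefficient_form.
Context {R : realType} {d : nat} (D : set 'rV[R]_d.+1) {V : completeNormedModType R}.
Context (a1 : ('rV[R]_d.+1 -> R) -> V -> V -> R) (C1 : R) (C1_gt0 : 0 < C1).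
Context (a1_linear : forall kappa kappa', Linfty_on D kappa -> Linfty_on D kappa' ->
  forall (c : R) w v,
  a1 (fun x => c * kappa x + kappa' x) w v = c * a1 kappa w v + a1 kappa' w v).
Context (a1_bounded : forall kappa, Linfty_on D kappa -> forall w v,
  ((a1 kappa w v)%:E <= C1%:E * ess_sup_on D (absf kappa) * (`|w| * `|v|)%:E)%E).
Implicit Types kappa : 'rV[R]_d.+1 -> R.

Lemma coef_form_bounded kappa M : bounded_coef D kappa ->
  (forall x, D x -> `|kappa x| <= M) -> form_bounded (a1 kappa) (C1 * M).
Proof.
move=> bk kM w v; rewrite -lee_fin.
apply: le_trans (a1_bounded (bounded_coef_Linfty bk) w v) _.
rewrite -mulrA !EFinM; apply: lee_wpmul2r; first by rewrite lee_fin mulr_ge0.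
by apply: lee_wpmul2l; [rewrite lee_fin ltW|exact: ess_sup_on_le].
Qed.

Lemma coef_form0 w v : a1 (fun=> 0) w v = 0.
Proof.
have b0 := bounded_coef_Linfty (bounded_coef_cst D 0).
have := a1_linear b0 b0 1 w v; rewrite mul1r addr0 mul1r => H.
by apply/eqP; rewrite -(inj_eq (addrI (a1 (fun=> 0) w v))) addr0 -H.
Qed.

Lemma coef_formZ c kappa w v : bounded_coef D kappa ->
  a1 (fun x => c * kappa x) w v = c * a1 kappa w v.
Proof.
move=> /bounded_coef_Linfty bk; rewrite -[RHS]addr0 -(coef_form0 w v).
rewrite -a1_linear//; last exact/bounded_coef_Linfty/bounded_coef_cst.
by congr (a1 _ w v); apply/funext => x; rewrite addr0.
Qed.

Lemma coef_formD kappa kappa' w v : bounded_coef D kappa -> bounded_coef D kappa' ->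
  a1 (fun x => kappa x + kappa' x) w v = a1 kappa w v + a1 kappa' w v.
Proof.
move=> /bounded_coef_Linfty bk /bounded_coef_Linfty bk'.
rewrite -[X in X + _]mul1r -a1_linear//.
by congr (a1 _ w v); apply/funext => x; rewrite mul1r.
Qed.

Lemma coef_form_sum (I : Type) (r : seq I) (P : pred I) (k : I -> 'rV[R]_d.+1 -> R) w v :
  (forall i, bounded_coef D (k i)) ->
  a1 (fun x => \sum_(i <- r | P i) k i x) w v = \sum_(i <- r | P i) a1 (k i) w v.
Proof.
move=> bk; elim: r => [|i r IH].
  rewrite big_nil -[RHS](coef_form0 w v).
  by congr (a1 _ w v); apply/funext => x; rewrite big_nil.
rewrite big_cons; case: ifPn => Pi; rewrite -IH.
  rewrite -(coef_formD _ _ (bk i) (bounded_coef_sum r P bk)).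
  by congr (a1 _ w v); apply/funext => x; rewrite big_cons Pi.
by congr (a1 _ w v); apply/funext => x; rewrite big_cons (negPf Pi).
Qed.

(* The form sees the coefficient only through its values on [D]: a coefficient vanishing
   on [D] has essential supremum 0. *)
Lemma coef_form_ext kappa kappa' w v : bounded_coef D kappa -> bounded_coef D kappa' ->
  {in D, kappa =1 kappa'} -> a1 kappa w v = a1 kappa' w v.
Proof.
move=> bk bk' kk'; wlog suff H : kappa kappa' bk bk' kk' / a1 kappa w v <= a1 kappa' w v.
  by apply/eqP; rewrite eq_le !H// => x Dx; rewrite kk'.
pose k := fun x => -1 * kappa' x + kappa x.
have kE : a1 k w v = a1 kappa w v - a1 kappa' w v.
  by rewrite /k a1_linear ?mulN1r 1?addrC//; exact: bounded_coef_Linfty.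
have k0 x : D x -> `|k x| <= 0.
  by move=> Dx; rewrite /k kk' ?mulN1r ?addNr ?normr0//; exact/mem_set.
have := coef_form_bounded (bounded_coef_linear _ bk' bk) k0 w v.
by rewrite -/k kE mulr0 !mul0r subr_le0.
Qed.

End coefficient_form.

Lemma biscalar_of {R : realType} {V : lmodType R} (a : V -> V -> R) :
  bilinear_for *%R *%R a -> exists A : {biscalar V}, forall w v, A w v = a w v.
Proof.
move=> a_bil.
pose m := bilinear_isBilinear.Build R V V R *%R *%R a a_bil.
pose A : {biscalar V} := HB.pack a m.
by exists A.
Qed.

(** * The series of the affine coefficient *)

Section affine_coefficient.
Context {R : realType} {d : nat} (D : set 'rV[R]_d.+1) (k : nat -> 'rV[R]_d.+1 -> R).
Context (rho : nat -> R) (rho_gt1 : forall j, 1 < rho j) (eps : R).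
Context (rho_weight : forall x, D x ->
  (\sum_(0 <= j <oo) (rho j * `|k j.+1 x|)%:E <= (k 0%N x - eps)%:E)%E).

Let rho_ge0 j : 0 <= rho j. Proof. exact/ltW/(lt_trans ltr01). Qed.

Lemma affine_coef0 : affine_coef k (fun=> 0) = k 0%N.
Proof.
apply/funext => x; rewrite /affine_coef (_ : (fun n => _) = fun=> 0).
  by rewrite lim_cst// addr0.
by apply/funext => n; rewrite big1// => j _; rewrite mul0r.
Qed.

Lemma weighted_sum_le J x : D x -> \sum_(j < J) rho j * `|k j.+1 x| <= k 0%N x - eps.
Proof.
move=> Dx; rewrite -lee_fin; apply: le_trans (rho_weight Dx).
rewrite -sumEFin -(big_mkord xpredT (fun j => (rho j * `|k j.+1 x|)%:E)).
by apply: nneseries_lim_ge => j _ _; rewrite lee_fin mulr_ge0.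
Qed.

(** Since [|y j| <= 1 < rho j], the weighted sums dominate the series of absolute values. *)
Lemma affine_series_cvg y x : param_cube y -> D x ->
  cvgn (fun n => \sum_(0 <= j < n) y j * k j.+1 x).
Proof.
move=> yc Dx; apply: (@normed_cvg _ R^o (fun j => y j * k j.+1 x)).
apply: nondecreasing_is_cvgn; first by apply: nondecreasing_series => j _ _; exact: normr_ge0.
exists (k 0%N x - eps) => _ [J _ <-]; rewrite /= /series /= big_mkord.
apply: le_trans (weighted_sum_le J Dx); apply: ler_sum => j _.
rewrite normrM ler_wpM2r//; apply: le_trans (ltW (rho_gt1 j)).
by rewrite ler_norml.
Qed.

(** Once [j < n], the partial sums differ by the constant [(t - y j) * k j.+1 x]; this also gives
    convergence for the modified parameter, whatever [t]. *)
Lemma affine_coef_with y j t x : param_cube y -> D x ->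
  affine_coef k [eta y with j |-> t] x = affine_coef k y x + (t - y j) * k j.+1 x.
Proof.
move=> yc Dx; rewrite /affine_coef -addrA; congr (_ + _); apply/cvg_lim => //.
have /(cvgD (affine_series_cvg yc Dx)) : (fun=> (t - y j) * k j.+1 x) @ \oo -->
  (t - y j) * k j.+1 x by exact: cvg_cst.
apply: cvg_trans; apply: near_eq_cvg; near=> n.
have jn : (j < n)%N by near: n; exact: nbhs_infty_gt.
rewrite -[LHS]/(\sum_(0 <= i < n) y i * k i.+1 x + (t - y j) * k j.+1 x).
rewrite /= !big_mkord (bigD1 (Ordinal jn)) //= [in RHS](bigD1 (Ordinal jn)) //= eqxx.
rewrite [in RHS](eq_bigr (fun i : 'I_n => y i * k i.+1 x)); first by ring.
by move=> i; rewrite -val_eqE /= => /negPf ->.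
Unshelve. all: by end_near. Qed.

Lemma affine_coef_measurable y :
  (forall j, measurable_fun (D : set (Rleb R d)) (k j : Rleb R d -> R)) ->
  param_cube y -> measurable_fun (D : set (Rleb R d)) (affine_coef k y : Rleb R d -> R).
Proof.
move=> mk yc.
apply: (@measurable_fun_cvg _ (Rleb R d) R D
    (fun n x => k 0%N x + \sum_(0 <= j < n) y j * k j.+1 x)) => [n|x Dx].
  apply: measurable_funD; first exact: mk.
  elim: n => [|n IH].
    rewrite (_ : (fun x => _) = fun=> 0); first exact: measurable_cst.
    by apply/funext => x; rewrite big_nil.
  rewrite (_ : (fun x => _) = fun x => \sum_(0 <= j < n) y j * k j.+1 x + y n * k n.+1 x).
    exact: (measurable_funD IH (measurable_funM (measurable_cst (y n)) (mk n.+1))).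
  by apply/funext => x; rewrite big_nat_recr.
apply: cvgD; first exact: cvg_cst.
exact: affine_series_cvg.
Qed.

End affine_coefficient.

(** * The abstract hypotheses verified for the parametrized problem *)

Theorem lemma3p5 (R : realType) (d : nat) (D : set 'rV[R]_d.+1)
  (D_open : open D) (D_bounded : bounded_set D)
  (D_connected : connected D) (D_nonempty : D !=set0)
  (V Q : completeNormedModType R) (V_Hilbert : Hilbert V) (Q_Hilbert : Hilbert Q)
  (f : {scalar V}) (f_continuous : continuous f)
  (g : {scalar Q}) (g_continuous : continuous g)
  (K : completeNormedModType R) (ev : K -> 'rV[R]_d.+1 -> R)
  (K_functions : separable_Banach_function_space D ev)
  (b : {bilinear V -> Q -> R | *%R & *%R})
  (a0 : {biscalar V})
  (a1 : ('rV[R]_d.+1 -> R) -> V -> V -> R)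
  (a := fun kappa w v => a0 w v + a1 kappa w v)
  (a1_bilinear : forall kappa, Linfty_on D kappa ->
     bilinear_for *%R *%R (a1 kappa))
  (a1_linear : forall kappa kappa', Linfty_on D kappa -> Linfty_on D kappa' ->
     forall (c : R) w v,
     a1 (fun x => c * kappa x + kappa' x) w v = c * a1 kappa w v + a1 kappa' w v)
  (c1 C1 : R) (c1_gt0 : 0 < c1) (C1_gt0 : 0 < C1)
  (a1_coercive : forall kappa, Linfty_on D kappa ->
     (forall x, D x -> 0 <= kappa x) -> forall v, kernel_form b v ->
     (c1%:E * ess_inf_on D kappa * (`|v| ^+ 2)%:E <= (a1 kappa v v)%:E)%E)
  (a1_bounded : forall kappa, Linfty_on D kappa -> forall w v,
     ((a1 kappa w v)%:E
        <= C1%:E * ess_sup_on D (absf kappa) * (`|w| * `|v|)%:E)%E)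
  (a1_young : forall kappa, Linfty_on D kappa -> forall w v,
     a1 kappa w v <= 2^-1 * (a1 (absf kappa) w w + a1 (absf kappa) v v))
  (theta Theta gamma delta alpha beta : R)
  (theta_gt0 : 0 < theta) (theta_lt : theta < Theta)
  (gamma_gt0 : 0 < gamma) (delta_gt0 : 0 < delta)
  (alpha_gt0 : 0 < alpha) (beta_gt0 : 0 < beta)
  (a_bounded : forall kappa, Linfty_on D kappa ->
     (forall x, D x -> theta <= kappa x <= Theta) ->
     forall w v, a kappa w v <= gamma * `|w| * `|v|)
  (a_coercive : forall kappa, Linfty_on D kappa ->
     (forall x, D x -> theta <= kappa x <= Theta) ->
     forall v, kernel_form b v -> alpha * `|v| ^+ 2 <= a kappa v v)
  (b_bounded : forall v q, b v q <= delta * `|v| * `|q|)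
  (b_inf_sup : (beta%:E <= inf_sup b)%E)
  (kappa_ : nat -> K)
  (kappa := affine_coef (fun j => ev (kappa_ j)))
  (kappa_min := ereal_inf [set (kappa y x)%:E | x in D & y in param_cube])
  (kappa_max := ereal_sup [set (kappa y x)%:E | x in D & y in param_cube])
  (theta_lt_kappa_min : (theta%:E < kappa_min)%E)
  (kappa_max_lt : (kappa_max < (Theta / 2)%:E)%E)
  (u : (nat -> R) -> V) (p : (nat -> R) -> Q)
  (up_solution : forall y, param_cube y ->
     saddle_point_solution (a (kappa y)) b f g (u y) (p y))
  (rho : nat -> R) (rho_gt1 : forall j, 1 < rho j)
  (eps : R) (theta_lt_eps : theta < eps) (eps_lt : (eps%:E < kappa_min)%E)
  (rho_weight : forall x, D x ->
     (\sum_(0 <= j <oo) (rho j * `|ev (kappa_ j.+1) x|)%:E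
        <= (ev (kappa_ 0%N) x - eps)%:E)%E)
  (t : R) (t_gt0 : 0 < t)
  (rho_summable : (\sum_(0 <= j <oo) (`|(rho j)^-1| `^ t)%:E < +oo)%E) :
  let s := 2 * t / (2 + t) in
  [/\ 0 < s < 2,
      forall nu, ex_Taylor_coef u nu /\ ex_Taylor_coef p nu,
      (\esum_(nu in [set: multi_index]) (`|Taylor_coef u nu| `^ s)%:E < +oo)%E
    & (\esum_(nu in [set: multi_index]) (`|Taylor_coef p nu| `^ t)%:E < +oo)%E].
Proof.
move=> s; pose k j := ev (kappa_ j).
have Theta_gt0 : 0 < Theta := lt_trans theta_gt0 theta_lt.
have mk j : measurable_fun (D : set (Rleb R d)) (k j : Rleb R d -> R).
  by have [_ _ _ /(_ (kappa_ j))[]] := K_functions.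
have kappa_bounds y x : param_cube y -> D x -> theta < kappa y x < Theta / 2.
  move=> yc Dx; have yx : [set (kappa y x)%:E | x in D & y in param_cube] (kappa y x)%:E.
    by exists x => //; exists y.
  rewrite -lte_fin -[in X in _ && X]lte_fin; apply/andP; split.
    by apply: lt_le_trans theta_lt_kappa_min _; exact: ereal_inf_lbound.
  by apply: le_lt_trans kappa_max_lt; exact: ereal_sup_ubound.
have Theta2_lt : Theta / 2 < Theta by rewrite ltr_pdivrMr// ltr_pMr// ltr1n.
have kappa_range y x : param_cube y -> D x -> theta <= kappa y x <= Theta.
  move=> yc /(kappa_bounds _ _ yc)/andP[h1 h2].
  by rewrite (ltW h1) (ltW (lt_trans h2 Theta2_lt)).
have kappa_bounded y : param_cube y -> bounded_coef D (kappa y).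
  move=> yc; split; first exact: (affine_coef_measurable rho_gt1 rho_weight).
  exists Theta => x Dx; have /andP[h1 h2] := kappa_range _ _ yc Dx.
  by rewrite ger0_norm// (le_trans (ltW theta_gt0)).
have cube0 : param_cube (fun=> 0 : R) by move=> j; rewrite oppr_le0 ler01.
have kappa0 : kappa (fun=> 0) = k 0%N by exact: affine_coef0.
have k0_le x : D x -> k 0%N x <= Theta.
  by move=> Dx; rewrite -kappa0; have /andP[] := kappa_range _ _ cube0 Dx.
have eps_gt0 : 0 < eps := lt_trans theta_gt0 theta_lt_eps.
have weighted_le J x : D x -> \sum_(j < J) rho j * `|k j.+1 x| <= k 0%N x - eps.
  by move=> Dx; exact: (@weighted_sum_le _ _ D k _ rho_gt1 _ rho_weight).
have rho_gt0 j : 0 < rho j := lt_trans ltr01 (rho_gt1 j).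
(* As [1 < rho j], one term of the weighted sum already dominates [|k j.+1 x|], and the whole sum is
   at most [k 0 x - eps <= Theta]. *)
have k_le j x : D x -> `|k j.+1 x| <= Theta.
  move=> Dx; have := weighted_le j.+1 x Dx; rewrite big_ord_recr /= => h.
  have : 0 <= \sum_(i < j) rho i * `|k i.+1 x| by apply: sumr_ge0 => i _; rewrite mulr_ge0// ltW.
  have : `|k j.+1 x| <= rho j * `|k j.+1 x| by rewrite ler_peMl// ltW.
  have := k0_le _ Dx; lra.
have k_bounded j : bounded_coef D (k j.+1) by split => //; exists Theta; exact: k_le.
have bilin_a1 kap : bounded_coef D kap -> bilinear_for *%R *%R (a1 kap).
  by move=> /bounded_coef_Linfty; exact: a1_bilinear.
(* The family [A] must be bilinear at every [y]; outside the cube [a0] is a placeholder. *)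
have /choice[A AE] y : exists F : {biscalar V}, param_cube y ->
    forall w v, F w v = a (kappa y) w v.
  have [yc|] := pselect (param_cube y); last by exists a0.
  have [F FE] := biscalar_of (bilin_a1 _ (kappa_bounded _ yc)).
  have [|F' F'E] := @biscalar_of _ _ (fun w v => a0 w v + F w v).
    split=> [v c w w'|w c v v'] /=.
      by rewrite (formDl a0) (formDl F) (formZl a0) (formZl F) mulrDr addrACA.
    by rewrite (formDr a0) (formDr F) (formZr a0) (formZr F) mulrDr addrACA.
  by exists F' => _ w v; rewrite F'E FE.
have /choice[B BE] j : exists F : {biscalar V}, forall w v, F w v = a1 (k j.+1) w v.
  exact/biscalar_of/bilin_a1.
have open_param (y : nat -> R) : open_cube y -> param_cube y.
  by move=> yc j; rewrite -ler_norml ltW.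
have open0 : open_cube (fun=> 0 : R) by move=> j; rewrite normr0.
have A_bounded y : open_cube y -> form_bounded (A y) gamma.
  move=> /open_param yc w v; rewrite AE//; apply: a_bounded.
    exact/bounded_coef_Linfty/kappa_bounded.
  by move=> x; exact: kappa_range.
have A_coercive y : open_cube y -> coercive_on_kernel b (A y) alpha.
  move=> /open_param yc v bv; rewrite AE//; apply: a_coercive => //.
    exact/bounded_coef_Linfty/kappa_bounded.
  by move=> x; exact: kappa_range.
have B_bounded j : form_bounded (B j) (C1 * Theta).
  move=> w v; rewrite BE.
  exact: (coef_form_bounded C1_gt0 a1_bounded (k_bounded j) (k_le j)).
have C1Theta_ge0 : 0 <= C1 * Theta by rewrite mulr_ge0// ltW.
have A_affine y j r : open_cube y -> `|r| < 1 ->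
    forall w v, A [eta y with j |-> r] w v = A y w v + (r - y j) * B j w v.
  move=> yo r1 w v; have yc := open_param _ yo.
  have yrc : param_cube [eta y with j |-> r] := open_param _ (open_cube_with j yo r1).
  rewrite !AE// BE /a -addrA; congr (_ + _).
  rewrite -(coef_formZ a1_linear)// addrC.
  have bZ := bounded_coefZ (r - y j) (k_bounded j).
  rewrite -(coef_formD a1_linear) //; last exact: kappa_bounded.
  (* The two coefficients are known to agree only on [D], where the series converges. *)
  apply: (coef_form_ext C1_gt0 a1_linear a1_bounded).
  - exact: kappa_bounded.
  - exact/bounded_coefD/kappa_bounded.
  - by move=> x /set_mem Dx; rewrite /kappa (affine_coef_with rho_gt1 rho_weight)// addrC.
have up_solution_open y : open_cube y -> saddle_point_solution (A y) b f g (u y) (p y).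
  move=> /open_param yc; have [e1 e2] := up_solution _ yc.
  by split => // v; rewrite AE.
have delta_ge0 := ltW delta_gt0.
have solves js y : open_cube y -> partials_equation b A B f g u p js y.
  move=> yo; have [] := partials_solve delta_ge0 beta_gt0 gamma_gt0 alpha_gt0 b_bounded b_inf_sup
    A_bounded A_coercive B_bounded (fun=> C1Theta_ge0) A_affine up_solution_open js yo.
  by [].
have t_equation nu J : nu != [fsfun] -> supported_below J nu ->
    saddle_point_solution (A (fun=> 0)) b
    (fun v => - \sum_(j < J | (0 < nu j)%N) B j (Taylor_coef u (pred_at nu j)) v)
    (fun=> 0) (Taylor_coef u nu) (Taylor_coef p nu).
  by apply: Taylor_coef_equation; exact: solves.
pose rk j x := rho j * k j.+1 x.
have rk_bounded j : bounded_coef D (rk j) by exact: bounded_coefZ.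
have rkn_bounded j : bounded_coef D (absf (rk j)) by exact: bounded_coef_norm.
pose m j v := a1 (absf (rk j)) v v.
have rkE j x : absf (rk j) x = rho j * `|k j.+1 x|.
  by rewrite /absf /rk normrM gtr0_norm.
have m_young j w v : `|rho j * B j w v| <= 2^-1 * (m j w + m j v).
  have E z : rho j * B j w z = a1 (rk j) w z by rewrite BE -(coef_formZ a1_linear).
  have Y z : rho j * B j w z <= 2^-1 * (m j w + m j z).
    by rewrite E; apply: a1_young; exact: bounded_coef_Linfty.
  (* The hypothesis [a1_young] is one-sided; since [m j] is even, using it at [v] and [- v] bounds
     the absolute value. *)
  have mN : m j (- v) = m j v.
    have [F FE] := biscalar_of (bilin_a1 _ (rkn_bounded j)).
    by rewrite /m -!FE -scaleN1r (formZl F) (formZr F) mulrA mulrNN !mul1r.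
  have := Y (- v); rewrite mN -scaleN1r (formZr (B j)) mulN1r mulrN => Yn.
  by rewrite ler_norml Y andbT lerNl.
have m_sumE J (I : pred nat) v :
    \sum_(j < J | I j) m j v = a1 (fun x => \sum_(j < J | I j) absf (rk j) x) v v.
  by rewrite (coef_form_sum a1_linear).
have sum_le J (I : pred nat) x : D x ->
    0 <= \sum_(j < J | I j) absf (rk j) x <= k 0%N x - eps.
  move=> Dx; rewrite sumr_ge0/=; last by move=> j _; exact: normr_ge0.
  apply: le_trans (weighted_le J x Dx); rewrite [leLHS]big_mkcond; apply: ler_sum => j _.
  by rewrite rkE; case: ifP => // _; rewrite mulr_ge0// ltW.
have m_sum J (I : pred nat) v : \sum_(j < J | I j) m j v <= C1 * Theta * `|v| ^+ 2.
  rewrite m_sumE expr2 mulrA; apply: (coef_form_bounded C1_gt0 a1_bounded).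
    exact: bounded_coef_sum.
  move=> x Dx; have /andP[h1 h2] := sum_le J I x Dx; rewrite ger0_norm//.
  by have := k0_le _ Dx; lra.
have a1_ge0 kap v : bounded_coef D kap -> (forall x, D x -> 0 <= kap x) ->
    kernel_form b v -> 0 <= a1 kap v v.
  move=> bk k0 bv; rewrite -lee_fin; have := a1_coercive _ (bounded_coef_Linfty bk) k0 _ bv.
  apply: le_trans.
  by rewrite !mule_ge0 ?lee_fin ?exprn_ge0 ?(ltW c1_gt0)// ess_inf_on_ge0.
have m_ge0 j v : kernel_form b v -> 0 <= m j v.
  by apply: a1_ge0 => [|x _]; [exact: rkn_bounded|exact: normr_ge0].
have m_kernel J v : kernel_form b v ->
    \sum_(j < J) m j v <= A (fun=> 0) v v - alpha * `|v| ^+ 2.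
  move=> bv; rewrite AE// /a kappa0 (m_sumE J xpredT).
  set S := fun x => \sum_(j < J) absf (rk j) x.
  have bS : bounded_coef D S by exact: bounded_coef_sum.
  have beps := bounded_coef_cst D eps.
  have bk0 : bounded_coef D (k 0%N) by rewrite -kappa0; exact: kappa_bounded.
  (* The slack in the weight condition, [kappa_0 - eps - sum_j rho_j |kappa_j|] over [j < J], is
     nonnegative on [D], hence so is its form on the kernel. *)
  pose rest x := -1 * (S x + eps) + k 0%N x.
  have bSeps := bounded_coefD bS beps.
  have brest : bounded_coef D rest := bounded_coef_linear (-1) bSeps bk0.
  have restE : a1 rest v v = a1 (k 0%N) v v - (a1 S v v + a1 (fun=> eps) v v).
    have e1 := a1_linear _ _ (bounded_coef_Linfty bSeps) (bounded_coef_Linfty bk0) (-1) v v.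
    by rewrite /rest e1 (coef_formD a1_linear _ _ bS beps) mulN1r addrC.
  have : 0 <= a1 rest v v.
    apply: (a1_ge0 _ _ brest _ bv) => x Dx; have /andP[_] := sum_le J xpredT x Dx.
    by rewrite /rest /S; lra.
  (* The constant [eps] is an admissible coefficient, as [theta < eps <= k 0 x <= Theta] on [D];
     coercivity there yields the term in [alpha]. *)
  have : alpha * `|v| ^+ 2 <= a (fun=> eps) v v.
    apply: (a_coercive _ (bounded_coef_Linfty beps) _ _ bv) => x Dx.
    rewrite (ltW theta_lt_eps) /=; have := k0_le _ Dx; have /andP[h1 h2] := sum_le J xpredT x Dx.
    lra.
  by rewrite restE /a; lra.
have s_bounds : 0 < s < 2.
  have t2 : 0 < 2 + t by rewrite addr_gt0.
  by rewrite /s divr_gt0 ?mulr_gt0//= ltr_pdivrMr//; lra.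
split => //.
- move=> nu; exact: (ex_partials_solution delta_ge0 beta_gt0 gamma_gt0 alpha_gt0 b_bounded
    b_inf_sup A_bounded A_coercive B_bounded (fun=> C1Theta_ge0) A_affine up_solution_open).
- have [C HC] := weighted_l2_bounded alpha_gt0 m_young m_sum m_ge0 m_kernel t_equation.
  exact: weighted_l2_summable HC.
- have [C HC] := weighted_sup_bounded beta_gt0 gamma_gt0 alpha_gt0 b_inf_sup C1Theta_ge0
    (A_bounded _ open0) m_young m_sum m_ge0 m_kernel t_equation.
  exact: weighted_sup_summable HC.
Qed.
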